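(* Let $\mathbb F_q$ be a finite field with $q$ elements and $\mathcal X=\{X_1,\dots,X_k\}$ with $k\ge1$. Define polynomials $F_T(q)$, indexed by finite full subtrees $T\in\mathcal{FFT}(\mathcal X)$, recursively by $$F_T(q)=q^{-1+\sharp V(T)}\prod_{\mathbf L\in\partial V(T)}q^{\sharp\{\mathbf X\in V^\circ(T)\,:\,\mathbf X<\mathbf L\}}-C_T(q),$$ $$C_T(q)=\sum_{T'\in\mathcal{FFT}(\mathcal X),\ T'<T}F_{T'}(q)\prod_{\mathbf L\in\partial V(T)}q^{\sharp\{\mathbf X\in V^\circ(T)\setminus V^\circ(T')\,:\,\mathbf X<\mathbf L\}}.$$ Then $$\sum_{A\in S\mathbb F_q\langle\!\langle X_1,\dots,X_k\rangle\!\rangle_{rat}^*}t^{\|A\|}=\sum_{T\in\mathcal{FFT}(\mathcal X)}F_T(q)\,t^{\sharp V^\circ(T)}$$ as formal power series in $t$. In particular, for every $n\ge0$ the polynomial $$F_n(q)=\sum_{T\in\mathcal{FFT}(\mathcal X),\ \sharp V^\circ(T)=n}F_T(q)\in\mathbb Z[q]$$ gives the number of elements of length exactly $n$ in $S\mathbb F_q\langle\!\langle X_1,\dots,X_k\rangle\!\rangle_{rat}^*$, i.e. of elements $A$ with $\|A\|=n$.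
   Context: Series. $\mathcal X^*$ is the free monoid on $\mathcal X$, with empty word $\emptyset$. For a field $\mathbb K$, $\mathbb K\langle\!\langle\mathcal X\rangle\!\rangle$ is the algebra of non-commutative formal power series $A=\sum_{\mathbf X\in\mathcal X^*}(A,\mathbf X)\mathbf X$ with the convolution product. A series is invertible iff its constant coefficient $\epsilon(A)$ is non-zero. $\mathbb K\langle\!\langle\mathcal X\rangle\!\rangle_{rat}$ is the smallest subalgebra containing $\mathcal X$ and closed under inversion of those of its elements that are invertible in $\mathbb K\langle\!\langle\mathcal X\rangle\!\rangle$. $S\mathbb K\langle\!\langle\mathcal X\rangle\!\rangle_{rat}^*$ is the multiplicative group of rational series with $\epsilon(A)=1$. For $\mathbf T\in\mathcal X^*$ put $\rho(\mathbf T)A=\sum_{\mathbf X}(A,\mathbf X\mathbf T)\mathbf X$, and let $\overline A$ be the linear span of all $\rho(\mathbf T)A$ (finite-dimensional for rational $A$). The length (norm) is $\|A\|=\dim(\overline A+\mathbb K)-1$, where $\mathbb K$ is the space of constant series. Trees. $\mathcal X^*$ is viewed as the vertex set of the infinite $k$-regular tree rooted at $\emptyset$; the $k$ children of a vertex $\mathbf X$ are $X_1\mathbf X,\dots,X_k\mathbf X$. A subtree $T$ (containing the root $\emptyset$) is full if each vertex of $T$ is either a leaf of $T$ (none of its children belong to $T$) or an interior vertex (all of its $k$ children belong to $T$). $V(T)$, $\partial V(T)$ and $V^\circ(T)$ are the sets of vertices, leaves and interior vertices. $\mathcal{FFT}(\mathcal X)$ is the set of all finite full subtrees, including the tree reduced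 to the root, whose only vertex $\emptyset$ is a leaf. For trees, $T'<T$ means that $V^\circ(T')$ is a strict subset of $V^\circ(T)$. Order. $\mathcal X$ is totally ordered, and the order is extended to $\mathcal X^*$ right-to-left lexicographically: $\mathbf Z<\mathbf XX\mathbf Z<\mathbf YY\mathbf Z$ for all $\mathbf X,\mathbf Y,\mathbf Z\in\mathcal X^*$ and all $X<Y$ in $\mathcal X$ (words are compared letter by letter starting from the right, a proper suffix being smaller). *)

(* Defs.v *)
From HB Require Import structures.
From mathcomp Require Import all_boot all_order all_algebra.
From mathcomp Require Import finmap.
From mathcomp Require Import all_classical.

Set Implicit Arguments.
Unset Strict Implicit.
Unset Printing Implicit Defensive.

Import Order.TTheory GRing.Theory Num.Theory.

Local Open Scope classical_set_scope.
Local Open Scope ring_scope.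

Section Span.
Variables (K : fieldType) (E : lmodType K).

Definition lspan (S : set E) : set E :=
  [set v | exists n (s : 'I_n -> E) (c : 'I_n -> K),
     (forall i, S (s i)) /\ v = \sum_(i < n) c i *: s i].

Definition lin_indep n (b : 'I_n -> E) : Prop :=
  forall c : 'I_n -> K, \sum_(i < n) c i *: b i = 0 -> forall i, c i = 0.

Definition has_dim (V : set E) (n : nat) : Prop :=
  exists b : 'I_n -> E, lin_indep b /\ lspan (range b) = V.

(* The value is 0 by convention if V is not a finite-dimensional subspace. *)
Definition dimension (V : set E) : nat := xget 0%N [set n | has_dim V n].

End Span.

(* A word X_1 ... X_n is the list [:: X_1; ...; X_n]; the coefficient (A, w)
   is A w. The alias keeps the convolution product below apart from the
   pointwise product which the library puts on functions. *)
Definition series (K : fieldType) (X : finType) : Type := seq X -> K.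

Section SeriesAlgebra.
Variables (K : fieldType) (X : finType).
Local Notation S := (series K X).
Implicit Types (A B C : S) (w : seq X) (a : K).

HB.instance Definition _ := Choice.copy S (seq X -> K^o).
HB.instance Definition _ := GRing.Lmodule.copy S (seq X -> K^o).

Definition series_one : S := fun w => (w == [::])%:R.

Definition series_mul A B : S :=
  fun w => \sum_(i < (size w).+1) A (take i w) * B (drop i w).

Lemma series_addE A B w : (A + B) w = A w + B w. Proof. by []. Qed.
Lemma series_scaleE a A w : (a *: A) w = a * A w. Proof. by []. Qed.

Lemma series_mul1 : left_id series_one series_mul.
Proof.
move=> A; apply/funext => w; rewrite /series_mul big_ord_recl /= take0 drop0.
rewrite mul1r big1 ?addr0 // => i _.
by rewrite /series_one; case: w i => [|x w] [i hi] //=; rewrite mul0r.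
Qed.

Lemma series_1mul : right_id series_one series_mul.
Proof.
move=> A; apply/funext => w; rewrite /series_mul big_ord_recr /=.
rewrite take_size drop_size mulr1 big1 ?add0r // => i _.
rewrite /series_one -size_eq0 size_drop subn_eq0 leqNgt ltn_ord mulr0 //.
Qed.

Lemma series_mulDl : left_distributive series_mul +%R.
Proof.
move=> A B C; apply/funext => w; rewrite series_addE /series_mul -big_split.
by apply: eq_bigr => i _; rewrite series_addE mulrDl.
Qed.

Lemma series_mulDr : right_distributive series_mul +%R.
Proof.
move=> A B C; apply/funext => w; rewrite series_addE /series_mul -big_split.
by apply: eq_bigr => i _; rewrite series_addE mulrDr.
Qed.

Lemma series_mul_nil A B : series_mul A B [::] = A [::] * B [::].
Proof. by rewrite /series_mul big_ord1. Qed.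

Lemma series_mul_cons A B x w :
  series_mul A B (x :: w) =
    A [::] * B (x :: w) + series_mul (fun u => A (x :: u)) B w.
Proof. by rewrite /series_mul big_ord_recl. Qed.

Lemma series_mul_scale a A B : series_mul (a *: A) B = a *: series_mul A B.
Proof.
apply/funext => w; rewrite series_scaleE /series_mul big_distrr /=.
by apply: eq_bigr => i _; rewrite series_scaleE mulrA.
Qed.

Lemma series_mulA : associative series_mul.
Proof.
move=> A B C; apply/funext => w; elim: w A => [|x w IHw] A.
  by rewrite !series_mul_nil mulrA.
rewrite !series_mul_cons IHw series_mul_nil mulrDr mulrA -addrA; congr (_ + _).
rewrite -series_scaleE -series_mul_scale -series_addE -series_mulDl.
congr (series_mul _ C w); apply/funext => u.
by rewrite series_addE series_scaleE series_mul_cons.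
Qed.

Lemma series_one_neq0 : series_one != 0.
Proof.
by apply/eqP => /(congr1 (fun A : S => A [::])) /eqP; rewrite oner_eq0.
Qed.

HB.instance Definition _ := GRing.Zmodule_isNzRing.Build S
  series_mulA series_mul1 series_1mul series_mulDl series_mulDr
  series_one_neq0.

Lemma series_scaleAl a A B : a *: (A * B) = (a *: A) * B.
Proof. exact/esym/series_mul_scale. Qed.

HB.instance Definition _ :=
  GRing.Lmodule_isLalgebra.Build K S series_scaleAl.

Lemma series_scaleAr a A B : a *: (A * B) = A * (a *: B).
Proof.
apply/funext => w; rewrite series_scaleE.
rewrite /GRing.mul /= /series_mul [LHS]big_distrr /=.
by apply: eq_bigr => i _; rewrite series_scaleE mulrCA.
Qed.

HB.instance Definition _ :=
  GRing.Lalgebra_isAlgebra.Build K S series_scaleAr.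

End SeriesAlgebra.

Section Rational.
Variables (K : fieldType) (X : finType).
Local Notation S := (series K X).

Definition epsilon (A : S) : K := A [::].

Definition letter (x : X) : S := fun w => (w == [:: x])%:R.

(* Inverses are taken in the algebra of all formal power series. *)
Definition inversion_closed (R : set S) : Prop :=
  forall A B : S, R A -> A * B = 1 -> B * A = 1 -> R B.

Definition rational : set S :=
  smallest (fun R : set S =>
    GRing.subalg_closed (mem R) /\ inversion_closed R) (range letter).

Definition SRat : set S := [set A | rational A /\ epsilon A = 1].

Definition rho (t : seq X) (A : S) : S := fun w => A (w ++ t).

Definition rho_closure (A : S) : set S := lspan [set rho t A | t in setT].

Definition constants : set S := [set c%:A | c in setT].

Definition norm (A : S) : nat :=
  (dimension [set B + C | B in rho_closure A & C in constants]).-1.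

End Rational.

Section Trees.
Variable X : finType.
Implicit Types (V : {fset seq X}) (w : seq X) (x : X).

Local Open Scope fset_scope.

Definition vleaves V : {fset seq X} :=
  [fset w in V | [forall x, x :: w \notin V]].

Definition vinterior V : {fset seq X} :=
  [fset w in V | [forall x, x :: w \in V]].

(* The parent of x :: w is w, so a subtree containing the root is a set of
   words containing [::] and closed under removal of the first letter. *)
Definition is_fft V : bool :=
  [&& [::] \in V,
      all (fun w => behead w \in V) V
    & all (fun w => (w \in vleaves V) || (w \in vinterior V)) V].

Record fft : Type := FFT { vertices : {fset seq X}; _ : is_fft vertices }.

HB.instance Definition _ := [isSub for vertices].
HB.instance Definition _ := [Choice of fft by <:].

Definition leaves (T : fft) := vleaves (vertices T).
Definition interior (T : fft) := vinterior (vertices T).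

Definition tree_lt (T' T : fft) : bool := interior T' `<` interior T.

Lemma fft_child (T : fft) x w :
  x :: w \in vertices T -> w \in interior T.
Proof.
case: T => V fV; rewrite /interior /= => xwV.
case/and3P: fV => _ /allP Vp /allP Vf.
have wV : w \in V by exact: (Vp _ xwV).
case/orP: (Vf _ wV) => //; rewrite !inE /= => /andP[_ /forallP /(_ x)].
by rewrite xwV.
Qed.

Lemma interior_child (T : fft) x w :
  w \in interior T -> x :: w \in vertices T.
Proof. by rewrite !inE /= => /andP[_ /forallP xV]; exact: xV. Qed.

Lemma fft_root (T : fft) : [::] \in vertices T.
Proof. by case: T => V /= /and3P[]. Qed.

Lemma vertices_sub (T' T : fft) :
  interior T' `<=` interior T -> vertices T' `<=` vertices T.
Proof.
move=> /fsubsetP sub; apply/fsubsetP => -[|x w] wT'; first exact: fft_root.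
by apply: interior_child; apply: sub; exact: fft_child wT'.
Qed.

Lemma finite_fft_sub (W : {fset seq X}) :
  finite_set [set T : fft | vertices T `<=` W].
Proof.
apply: (@sub_finite_set _ _
  (vertices @^-1` [set V | V \in fpowerset W]%classic)).
  by move=> T /= TW; rewrite fpowersetE.
by apply: finite_preimage (finite_fset _) => T T' _ _; exact: val_inj.
Qed.

Lemma finite_tree_lt (T : fft) : finite_set [set T' | tree_lt T' T].
Proof.
apply: sub_finite_set (finite_fft_sub (vertices T)) => T' /= /fproper_sub.
exact: vertices_sub.
Qed.

Lemma finite_words n : finite_set [set w : seq X | (size w <= n)%N].
Proof.
elim: n => [|n IHn].
  apply: sub_finite_set (finite_set1 [::]) => w /=.
  by rewrite leqn0 size_eq0 => /eqP.
have fin2 : finite_set [set x :: w | x in [set: X] & w in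
    [set w : seq X | (size w <= n)%N]]%classic.
  by apply: finite_image2 => //; exact: finite_finset.
have finU : finite_set ([set [::]] `|` [set x :: w | x in [set: X] & w in
    [set w : seq X | (size w <= n)%N]])%classic.
  by rewrite finite_setU; split=> //; exact: finite_set1.
apply: sub_finite_set finU => -[|x w] /= sw; first by left.
by right; exists x => //; exists w.
Qed.

Lemma fft_size (T : fft) w :
  w \in vertices T -> (size w <= #|` interior T|)%N.
Proof.
have cards (n : nat) (u : seq X) : u \in vertices T -> size u = n ->
    (n <= #|` [fset v in interior T | size v < n]|)%N.
  elim: n u => [|n IHn] [|x u] // xuT [sz].
  have uI := fft_child xuT; have uT : u \in vertices T.
    by move: uI; rewrite !inE /= => /andP[].
  apply: leq_ltn_trans (IHn u uT sz) _; apply: fproper_ltn_card.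
  rewrite fproperE; apply/andP; split.
    by apply/fsubsetP => v; rewrite !inE => /andP[-> /ltnW].
  apply/negP => /fsubsetP /(_ u); rewrite !inE sz ltnn ltnSn andbF andbT.
  by move: uI; rewrite !inE => -> /(_ isT).
move=> wT; apply: leq_trans (cards _ w wT erefl) _.
by apply: fsubset_leq_card; apply/fsubsetP => v; rewrite !inE => /andP[].
Qed.

Lemma finite_fft_card n : finite_set [set T : fft | #|` interior T| = n].
Proof.
have := finite_words n; move=> /finite_fsetP[W WE].
apply: sub_finite_set (finite_fft_sub W) => T /= Tn.
apply/fsubsetP => w /fft_size; rewrite Tn => wn.
by have : [set` W]%classic w by rewrite -WE.
Qed.

End Trees.

Section Polynomials.
Variables (d : Order.disp_t) (X : finOrderType d).
Implicit Types (T : fft X) (I : {fset seq X}) (Z L : seq X).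

Definition word_lt Z L : bool :=
  ((rev Z : seqlexi X) < (rev L : seqlexi X))%O.

Lemma word_lt_suffix (x : X) (u z : seq X) : word_lt z (u ++ x :: z).
Proof.
rewrite /word_lt rev_cat rev_cons -cats1 -catA.
by elim: (rev z) => [|a s IH] //=; rewrite ltxi_cons lexx /=.
Qed.

Lemma word_lt_letter (x y : X) (u v z : seq X) :
  (x < y)%O -> word_lt (u ++ x :: z) (v ++ y :: z).
Proof.
move=> xy; rewrite /word_lt !rev_cat !rev_cons -!cats1 -!catA.
elim: (rev z) => [|a s IH] /=; rewrite ltxi_cons ?lexx //=.
by rewrite (ltW xy) leNgt xy.
Qed.

Definition below I L : nat := #|` [fset Z in I | word_lt Z L]%fset|.

Definition leaf_prod T I : {poly int} :=
  \prod_(L <- leaves T) 'X^(below I L).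

(* The recursion on T' < T is run with fuel n; see tree_polyE. *)
Fixpoint tree_poly_rec (n : nat) T : {poly int} :=
  if n is m.+1 then
    'X^(#|` vertices T|.-1) * leaf_prod T (interior T)
    - \sum_(T' \in [set T' | tree_lt T' T])
        tree_poly_rec m T' * leaf_prod T (interior T `\` interior T')%fset
  else 0.

Definition tree_poly T : {poly int} :=
  tree_poly_rec (#|` interior T|).+1 T.

Definition tree_corr T : {poly int} :=
  \sum_(T' \in [set T' | tree_lt T' T])
    tree_poly T' * leaf_prod T (interior T `\` interior T')%fset.

Lemma tree_poly_recE n T : (#|` interior T| < n)%N ->
  tree_poly_rec n T = tree_poly T.
Proof.
have gen (m p : nat) U : (#|` interior U| < m)%N -> (#|` interior U| < p)%N ->
    tree_poly_rec m U = tree_poly_rec p U.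
  elim: m p U => [|m IHm] [|p] U //= Um Up; congr (_ - _).
  apply: eq_fsbigr => U'; rewrite inE => /fproper_ltn_card lt; congr (_ * _).
  by apply: IHm; apply: leq_trans lt _.
by move=> Tn; apply: gen.
Qed.

Lemma tree_polyE T :
  tree_poly T =
    'X^(#|` vertices T|.-1) * leaf_prod T (interior T) - tree_corr T.
Proof.
rewrite {1}/tree_poly /=; congr (_ - _).
apply: eq_fsbigr => T'; rewrite inE => /fproper_ltn_card lt.
by rewrite tree_poly_recE.
Qed.

Definition level_poly (n : nat) : {poly int} :=
  \sum_(T \in [set T : fft X | #|` interior T| = n]) tree_poly T.

End Polynomials.

(* The formal power series sum_(i in D) c i t^(wt i), given by its sequence of
   coefficients; it makes sense when each weight occurs finitely often in D. *)
Definition gen_series (I : choiceType) (D : set I) (c : I -> int)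
    (wt : I -> nat) : nat -> int :=
  fun n => \sum_(i \in D `&` [set i | wt i = n]) c i.

(* Main.v *)
(** The recursion defining [F_T] makes sense for any total order on words in
    which [w < x :: w]. For another order the individual polynomials change,
    but the sum over the trees with n interior vertices does not: the sum over
    [T > T'] of the products of leaf weights satisfies a recursion (inspect the
    smallest pending vertex: it is a leaf, or it is interior and has #|X|
    children) which does not mention the order, and [T'] enters it only
    through its number of leaves.

    With the lexicographic order, [F_T] need not count series. Replace it by
    an order [wval] which is moreover compatible with left multiplication by a
    letter. The words [w] for which [rho w A], modulo constants, is not spanned
    by the [rho u A] with [u < w] are then the interior vertices of a tree [T(A)],
    finite exactly when [A] is rational, and with [norm A] elements. A tree [T]
    together with coefficients expressing, modulo constants, each [rho l A] ([l]
    a leaf) through the [rho y A] ([y < l] interior), and with the values of [A]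
    at the vertices other than the root, determines [A]; a given [A] arises from
    [T] iff [T(A) <= T], and then from [leaf_weight] many choices of coefficients.
    So the numbers of series with [T(A) = T] satisfy the recursion of the
    [F_T] for the order [wval]. *)

Require Import Defs.
From mathcomp Require Import all_boot all_order all_algebra.
From mathcomp Require Import finmap.
From mathcomp Require Import all_classical.

Import Order.TTheory GRing.Theory Num.Theory.

Set Implicit Arguments.
Unset Strict Implicit.
Unset Printing Implicit Defensive.

Local Open Scope classical_set_scope.
Local Open Scope card_scope.
Local Open Scope ring_scope.

(** * Finite full trees *)

Section TreeFacts.
Local Open Scope fset_scope.
Variable X : finType.
Hypothesis hX : (0 < #|X|)%N.
Implicit Types (T : fft X) (w u : seq X) (x : X).

Lemma vinteriorE (V : {fset seq X}) w :
  (w \in vinterior V) = (w \in V) && [forall x, x :: w \in V].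
Proof. by rewrite !inE. Qed.

Lemma vleavesE (V : {fset seq X}) w :
  (w \in vleaves V) = (w \in V) && [forall x, x :: w \notin V].
Proof. by rewrite !inE. Qed.

Lemma vertices_consE T x w : (x :: w \in vertices T) = (w \in interior T).
Proof. by apply/idP/idP; [exact: fft_child | exact: interior_child]. Qed.

Lemma interior_sub T : interior T `<=` vertices T.
Proof. by apply/fsubsetP => w; rewrite !inE => /andP[]. Qed.

Lemma interior_behead T x w : x :: w \in interior T -> w \in interior T.
Proof. by move=> /(fsubsetP (interior_sub T)); exact: fft_child. Qed.

Lemma interior_suffix T u w : u ++ w \in interior T -> w \in interior T.
Proof. by elim: u => //= x u IHu /interior_behead. Qed.

(** The existence of a letter makes the two conditions exclusive: a child cannot be both present and
    absent. *)
Lemma leavesE T w : (w \in leaves T) = (w \in vertices T) && (w \notin interior T).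
Proof.
rewrite !inE /=; case wT: (w \in vertices T) => //=.
apply/forallP/idP => [lw|]; last first.
  move=> /forallP nall x; apply/negP => xw; apply: nall => y.
  by move: xw; rewrite !vertices_consE.
have /card_gt0P[x _] := hX.
by apply/negP => /forallP /(_ x) xw; have := lw x; rewrite xw.
Qed.

Lemma leaves_sub T : leaves T `<=` vertices T.
Proof. by apply/fsubsetP => w; rewrite leavesE => /andP[]. Qed.

Lemma leaf_notin_interior T w : w \in leaves T -> w \notin interior T.
Proof. by rewrite leavesE => /andP[]. Qed.

(** Removing first letters leads towards the root; the first vertex of [T] met on the way is a
    leaf. *)
Lemma leaf_suffix T w : w \notin interior T ->
  exists u l, w = u ++ l /\ l \in leaves T.
Proof.
elim: w => [|x w IHw] nw.
  by exists [::], [::]; rewrite leavesE nw fft_root.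
have [wI|nwI] := boolP (w \in interior T).
  by exists [::], (x :: w); rewrite leavesE nw vertices_consE wI.
by have [u [l [-> lT]]] := IHw nwI; exists (x :: u), l.
Qed.

Lemma interior_inj : injective (@interior X).
Proof.
move=> T T' TT'; apply: val_inj; apply/fsetP => -[|x w] /=.
  by rewrite !fft_root.
by rewrite !vertices_consE TT'.
Qed.

(** The vertices are the root and all children of [I]; closure under removal of the first letter
    puts [I] itself among them. *)
Lemma fft_of_interior (I : {fset seq X}) :
  (forall x w, x :: w \in I -> w \in I) -> exists T, interior T = I.
Proof.
move=> Ib.
pose V : {fset seq X} :=
  [::] |` [fset x :: w | x in enum X, w in I].
have Vc x w : (x :: w \in V) = (w \in I).
  rewrite !inE /=; apply/imfset2P/idP => [[y _ [u uI [_ ->]]]//|wI].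
  by exists x; rewrite ?mem_enum //; exists w.
have IV w : w \in I -> w \in V.
  by case: w => [|x w] wI; rewrite ?Vc ?inE //; exact: Ib wI.
have VI w : (w \in vinterior V) = (w \in I).
  rewrite vinteriorE; apply/andP/idP => [[_ /forallP wV]|wI].
    by have /card_gt0P[x _] := hX; rewrite -(Vc x); exact: wV.
  by split; [exact: IV|apply/forallP => x; rewrite Vc].
have VF : is_fft V.
  apply/and3P; split; first by rewrite !inE.
  - apply/allP => -[|x w] /= wV; first by rewrite !inE.
    have {wV} : x :: w \in V by [].
    by rewrite Vc; exact: IV.
  apply/allP => w wV; rewrite VI vleavesE.
  case wI: (w \in I); rewrite ?orbT ?orbF //.
  by apply/andP; split=> //; apply/forallP => x; rewrite Vc wI.
by exists (FFT VF); apply/fsetP => w; rewrite -VI.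
Qed.

(** Every vertex except the root is a child of exactly one interior vertex. *)
Lemma card_vertices T : #|` vertices T| = (#|X| * #|` interior T|).+1.
Proof.
have -> : (#|X| * #|` interior T|).+1 =
    size ([::] :: [seq x :: w | x <- enum X, w <- interior T]).
  by rewrite /= size_allpairs -cardE.
apply/perm_size/uniq_perm => [|/=|[|x w]]; first exact: fset_uniq.
- apply/andP; split; first by apply/allpairsP => -[[x w] []].
  by apply: allpairs_uniq => [||[x u] [y v] /= _ _ [-> ->]//];
    rewrite ?enum_uniq ?fset_uniq.
- by rewrite inE eqxx; exact: fft_root.
rewrite inE /= -[LHS]/(_ \in vertices T) vertices_consE.
apply/idP/allpairsP => [wI|[[y u] /= [_ uI [_ ->]]]//].
by exists (x, w); rewrite mem_enum.
Qed.

Lemma card_leaves T : #|` leaves T| = (#|` vertices T| - #|` interior T|)%N.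
Proof.
rewrite -cardfsDS ?interior_sub //; congr #|` _|; apply/fsetP => w.
by rewrite leavesE in_fsetD andbC.
Qed.
End TreeFacts.

(** * Weighted sums over trees *)

Section Levels.
Variable X : finType.
Implicit Types (T : fft X).

Definition level n : {fset fft X} :=
  fset_set [set T : fft X | #|` interior T|%fset = n].

Lemma in_level n T : (T \in level n) = (#|` interior T|%fset == n).
Proof.
rewrite in_fset_set; last exact: finite_fft_card.
by apply/idP/eqP => [/[!inE]|/[!inE]].
Qed.

Definition subtrees T : {fset fft X} :=
  fset_set [set T' | tree_lt T' T].

Lemma in_subtrees T T' : (T' \in subtrees T) = tree_lt T' T.
Proof.
rewrite in_fset_set; last exact: finite_tree_lt.
by apply/idP/idP => /[!inE].
Qed.

End Levels.

Section Forests.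
Local Open Scope fset_scope.
Local Open Scope ring_scope.
Variable X : finType.
Hypothesis hX : (0 < #|X|)%N.
Implicit Types (T : fft X) (w u : seq X) (x : X).

Variable q : int.

(* The sum, over the forests with [j] interior vertices grown at [p] roots, of
   the product over the leaves L of [q ^+ (c + number of interior X < L)].
   Only the smallest pending vertex is examined: it is a leaf or has #|X|
   children. *)
Fixpoint forest_sum (j : nat) : nat -> nat -> int :=
  if j is j'.+1 then
    fix fs (p c : nat) : int :=
      if p is p'.+1 then
        q ^+ c * fs p' c + forest_sum j' (#|X| + p') c.+1
      else 0
  else fun p c => q ^+ (c * p).

Lemma forest_sumS j p c : forest_sum j.+1 p.+1 c =
  q ^+ c * forest_sum j.+1 p c + forest_sum j (#|X| + p) c.+1.
Proof. by []. Qed.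

(** Strict total orders in which a vertex precedes its children. The level sums depend on nothing
    else about the order. *)
Definition word_order (lt : rel (seq X)) : Prop :=
  [/\ irreflexive lt, transitive lt,
      forall u w, u != w -> lt u w || lt w u
    & forall x w, lt w (x :: w)].

Variable lt : rel (seq X).
Hypothesis ltP : word_order lt.

Definition leaf_weight (L I : {fset seq X}) : int :=
  \prod_(l <- L) q ^+ #|` [fset Z in I | lt Z l]|.

Lemma in_below (I : {fset seq X}) l Z :
  (Z \in [fset Z in I | lt Z l]) = (Z \in I) && lt Z l.
Proof. by rewrite !inE. Qed.

Lemma lt_suffix u w : u != [::] -> lt w (u ++ w).
Proof.
have [_ tr _ sfx] := ltP; elim: u => // x u IHu _.
have [->|u0] := eqVneq u [::]; first exact: sfx.
exact: tr (IHu u0) (sfx _ _).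
Qed.

Lemma fset_min (P : {fset seq X}) : P != fset0 ->
  exists2 p, p \in P & {in P, forall l, l != p -> lt p l}.
Proof.
have [_ tr tot _] := ltP.
have [n] := ubnP #|` P|; elim: n P => // n IHn P Pn P0.
have /fset0Pn[a aP] := P0.
have [P1|Pa0] := eqVneq (P `\ a) fset0.
  exists a => // l lP la; have : l \in P `\ a by rewrite !inE la lP.
  by rewrite P1.
have [|p] := IHn (P `\ a) _ Pa0; first by rewrite (cardfsD1 a) aP in Pn.
rewrite !inE => /andP[pa pP] pmin.
have [lpa|] := boolP (lt p a).
  exists p => // l lP lp; have [->//|la] := eqVneq l a.
  by apply: pmin; rewrite // !inE la.
move=> npa; have lap : lt a p by have := tot _ _ pa; rewrite (negPf npa).
exists a => // l lP la; have [->//|lp] := eqVneq l p.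
by apply: tr lap _; apply: pmin; rewrite // !inE la.
Qed.

Lemma fft_grow T p : p \in leaves T -> exists T',
  interior T' = p |` interior T /\
  leaves T' = (leaves T `\ p) `|` [fset x :: p | x in X].
Proof.
move=> pT; have pV := fsubsetP (leaves_sub hX T) _ pT.
have [|T' T'E] := fft_of_interior hX (I := p |` interior T).
  move=> x w; rewrite !in_fset1U => /orP[/eqP xwp|/interior_behead->]; rewrite ?orbT //.
  by move: pV; rewrite -xwp vertices_consE => ->; rewrite orbT.
exists T'; split=> //; apply/fsetP => w.
rewrite in_fsetU in_fsetD1 !leavesE // T'E in_fset1U negb_or.
have -> : (w \in [fset x :: p | x in X]) = if w is x :: v then v == p else false.
  apply/imfsetP/idP => [[x _ ->] /=|]; first by rewrite eqxx.
  case: w => // x v /eqP ->.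
  by exists x.
case: w => [|x w]; first by rewrite !fft_root orbF /=.
rewrite !vertices_consE T'E in_fset1U.
have [->|wp] := eqVneq w p; last by rewrite orbF andbCA.
rewrite orbT; have pnI := leaf_notin_interior hX pT.
rewrite [X in _ && ~~ X](contraNF _ pnI); last by move/interior_behead.
rewrite andbT /=; apply/eqP => /(congr1 size) /= /eqP.
by rewrite gtn_eqF.
Qed.

(** A vertex interior in [T] but not in [T0] has a leaf of [T0] as suffix. That leaf is interior in
    [T], hence outside [D], hence not before [p]; and suffixes come first. *)
Lemma leaf_lt_interior T0 T (D : {fset seq X}) p Z :
    (forall l, l \in leaves T0 `\` D -> l != p -> lt p l) ->
    fdisjoint D (interior T) ->
  Z \in interior T -> Z \notin interior T0 -> (Z == p) || lt p Z.
Proof.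
have [irr tr tot sfx] := ltP.
move=> pmin DT ZT /(leaf_suffix hX)[u [l [Zul lT0]]].
have lI : l \in interior T by apply: (@interior_suffix _ _ u); rewrite -Zul.
have lD : l \notin D by apply: contraTN lI; move: l {Zul lT0} ; apply/fdisjointP.
have [lp|lp] := eqVneq l p.
  have [u0|u0] := eqVneq u [::]; first by rewrite Zul u0 lp eqxx.
  by rewrite Zul -lp lt_suffix ?orbT.
have pl : lt p l by apply: pmin; rewrite // in_fsetD lD.
have [u0|u0] := eqVneq u [::]; first by rewrite Zul u0 pl orbT.
by rewrite Zul (tr _ _ _ pl) ?orbT ?lt_suffix.
Qed.

(** [T0] is the part already explored, [D] its leaves decided to remain leaves, and its other leaves
    are pending. All counted vertices precede every pending leaf, so one exponent is common to them.
    The smallest pending leaf is decided first, because later growth cannot change its weight. *)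
Lemma forest_sumE T' n j p T0 (D : {fset seq X}) :
  (#|` interior T0| + j)%N = n -> #|` leaves T0 `\` D| = p ->
  interior T' `<=` interior T0 -> D `<=` leaves T0 ->
  (forall Z l, Z \in interior T0 `\` interior T' -> l \in leaves T0 `\` D ->
     lt Z l) ->
  \sum_(T <- level X n | (interior T0 `<=` interior T) &&
                         fdisjoint D (interior T))
    leaf_weight (leaves T `\` D) (interior T `\` interior T') =
  forest_sum j p #|` interior T0 `\` interior T'|.
Proof.
have [irr tr tot sfx] := ltP.
elim: j p T0 D => [|j IHj] p T0 D.
  rewrite addn0 => cT0 cp sub sD ltD.
  have dD : fdisjoint D (interior T0).
    by apply/fdisjointP => w /(fsubsetP sD) /(leaf_notin_interior hX).
  (* No interior vertex is left to add, so [T0] is the only tree in the sum. *)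
  rewrite big_mkcond (bigD1_seq T0) ?fset_uniq ?in_level ?cT0 //=.
  rewrite fsubset_refl dD /= big_seq_cond big1 ?addr0; last first.
    move=> T /andP[]; rewrite in_level => /eqP cT /eqP TT0.
    case: ifP => // /andP[T0T _]; case: TT0.
    by apply: interior_inj; apply/esym/eqP; rewrite eqEfcard T0T cT cT0 leqnn.
  rewrite /leaf_weight (eq_big_seq (fun=> q ^+ #|` interior T0 `\` interior T'|)).
    by rewrite big_const_seq count_predT iter_mulr_1 -exprM -cp.
  move=> l lP; congr (_ ^+ #|` _|); apply/fsetP => Z.
  by rewrite in_below andb_idr // => ZI; exact: ltD.
elim: p D => [|p IHp] D cT0 cp sub sD ltD.
  (* With no pending leaf, a new interior vertex would force a leaf in [D] to become interior. *)
  rewrite big_seq_cond big1 // => T /andP[]; rewrite in_level => /eqP cT.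
  move=> /andP[T0T /fdisjointP dDT]; exfalso.
  have TT0 : interior T `<=` interior T0.
    apply/fsubsetP => w wT; apply: contraT => /(leaf_suffix hX)[u [l [wul lT0]]].
    have lD : l \in D.
      apply: contraT => lD; have : l \in leaves T0 `\` D by rewrite in_fsetD lD.
      by move/cardfs0_eq: cp => ->.
    move/negP: (dDT _ lD); elim; apply: (@interior_suffix _ _ u).
    by rewrite -wul.
  by have := fsubset_leq_card TT0; rewrite cT -cT0 addnS ltnNge leq_addr.
have /fset_min[l lP lmin] : leaves T0 `\` D != fset0 by rewrite -cardfs_gt0 cp.
have [lD lT0] : l \notin D /\ l \in leaves T0.
  by move: lP; rewrite in_fsetD => /andP[].
have lnT0 := leaf_notin_interior hX lT0.
(* Trees keeping [l] as a leaf give the first term, with [l] moved into [D]. *)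
rewrite forest_sumS (bigID (fun T => l \in interior T)) [LHS]addrC; congr (_ + _).
  pose D' := l |` D.
  have D'E : leaves T0 `\` D' = (leaves T0 `\` D) `\ l.
    by rewrite fsetDDl fsetUC.
  have cD' : #|` leaves T0 `\` D'| = p.
    by rewrite D'E; move: cp; rewrite (cardfsD1 l) lP => -[].
  have sD' : D' `<=` leaves T0.
    by rewrite fsubUset fsub1set lT0.
  have ltD' Z l' : Z \in interior T0 `\` interior T' ->
      l' \in leaves T0 `\` D' -> lt Z l'.
    by rewrite D'E in_fsetD1 => ZI /andP[_ l'D]; exact: ltD.
  rewrite -(IHp D' cT0 cD' sub sD' ltD') mulr_sumr.
  rewrite [LHS](eq_bigl (fun T => (interior T0 `<=` interior T) &&
      fdisjoint D' (interior T))); last first.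
    by move=> T; rewrite fdisjointU1X -andbA; congr (_ && _); exact: andbC.
  apply: eq_bigr => T /andP[T0T].
  rewrite fdisjointU1X => /andP[lT dDT].
  have lLT : l \in leaves T.
    rewrite leavesE // lT (fsubsetP (vertices_sub T0T)) //.
    exact: (fsubsetP (leaves_sub hX T0)).
  rewrite /leaf_weight [LHS](big_fsetD1 l) /= ?in_fsetD ?lD //.
  rewrite fsetDDl fsetUC; congr (_ ^+ #|` _| * _).
  (* Interior vertices of [T] outside [T0] come at or after [l], so those counted below [l] are
     exactly the ones already counted in [T0]. *)
  apply/fsetP => Z; rewrite in_below !in_fsetD.
  case ZT': (Z \in interior T') => //=.
  have [ZT0|ZT0] := boolP (Z \in interior T0).
    by rewrite (fsubsetP T0T) //= ltD // in_fsetD ZT' ZT0.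
  apply/negP => /andP[ZT Zl].
  have := leaf_lt_interior lmin dDT ZT ZT0; case/orP => [/eqP Zl'|lZ].
    by move: Zl; rewrite Zl' irr.
  by have := tr _ _ _ Zl lZ; rewrite irr.
(* Trees with [l] interior: its children become pending, and [l], which precedes every leaf now
   pending, raises the common exponent by one. *)
have [T1 [T1I T1L]] := fft_grow lT0.
have cT1 : #|` interior T1 `\` interior T'| =
    #|` interior T0 `\` interior T'|.+1.
  have -> : interior T1 `\` interior T' = l |` (interior T0 `\` interior T').
    rewrite T1I fsetDUl; congr (_ `|` _); apply/fsetDidPl.
    by rewrite fdisjoint1X; apply: contraNN lnT0; apply: fsubsetP.
  by rewrite cardfsU1 in_fsetD (negPf lnT0) andbF.
have xlnI x : x :: l \notin vertices T0 by rewrite vertices_consE.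
have T1D : leaves T1 `\` D =
    ((leaves T0 `\` D) `\ l) `|` [fset x :: l | x in X].
  rewrite T1L fsetDUl; congr (_ `|` _).
    by rewrite !fsetDDl fsetUC.
  apply/fsetDidPl/fdisjointP => w /imfsetP[x _ ->]; apply: contraNN (xlnI x).
  by move/(fsubsetP sD)/(fsubsetP (leaves_sub hX T0)).
rewrite -cT1 -(IHj _ T1 D).
- apply: eq_bigl => T; rewrite T1I fsubUset fsub1set.
  by rewrite -[RHS]andbA; exact: andbC.
- by rewrite T1I cardfsU1 lnT0 -cT0 addnS.
- have dP : fdisjoint ((leaves T0 `\` D) `\ l) [fset x :: l | x in X].
    rewrite fdisjoint_sym; apply/fdisjointP => w /imfsetP[x _ ->].
    apply: contraNN (xlnI x); rewrite in_fsetD1 in_fsetD => /and3P[_ _].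
    exact: (fsubsetP (leaves_sub hX T0)).
  have := cardfsUI ((leaves T0 `\` D) `\ l) [fset x :: l | x in X].
  rewrite -T1D (eqP dP) cardfs0 addn0 => ->; rewrite addnC; congr (_ + _)%N.
    by rewrite card_imfset /= ?[RHS]cardE // => x y [].
  by move: cp; rewrite (cardfsD1 l) lP => -[].
- by rewrite T1I fsubsetU // sub orbT.
- rewrite T1L; apply/fsubsetP => w wD; rewrite in_fsetU in_fsetD1.
  by rewrite (fsubsetP sD) // andbT (contraNneq _ lD) // => <-.
move=> Z l'; rewrite T1I T1D in_fsetD in_fset1U in_fsetU in_fsetD1.
move=> /andP[ZT' ZI] l'P.
have Zl : Z != l -> lt Z l.
  move=> Zl; apply: ltD lP; rewrite in_fsetD ZT'.
  by move: ZI; rewrite (negPf Zl).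
case/orP: l'P => [/andP[l'l l'P]|/imfsetP[x _ ->]].
  case/orP: ZI => [/eqP ->|ZI]; first exact: lmin.
  by apply: ltD l'P; rewrite in_fsetD ZT'.
have [->|Zl'] := eqVneq Z l; first exact: sfx.
exact: tr (Zl Zl') (sfx _ _).
Qed.

(** This is the start of the exploration: all leaves of [T'] are pending and no vertex is counted
    yet. *)
Lemma subtree_sum T' n : (#|` interior T'| <= n)%N ->
  \sum_(T <- level X n | interior T' `<=` interior T)
    leaf_weight (leaves T) (interior T `\` interior T') =
  forest_sum (n - #|` interior T'|) #|` leaves T'| 0.
Proof.
move=> le_n; rewrite -[in RHS](cardfs0 (seq X)) -(fsetDv (interior T')).
rewrite -(@forest_sumE T' n _ _ T' fset0) ?subnKC ?fsetD0 ?fsub0set //.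
  by apply: eq_big => [T|T _]; rewrite ?fdisjoint0X ?andbT // fsetD0.
by move=> Z l; rewrite fsetDv.
Qed.

Definition tree_recursion (f : fft X -> int) : Prop := forall T,
  f T = q ^+ #|` vertices T|.-1 * leaf_weight (leaves T) (interior T)
      - \sum_(T' <- subtrees T)
          f T' * leaf_weight (leaves T) (interior T `\` interior T').

Lemma subtrees_by_level n T (g : fft X -> int) : #|` interior T| = n ->
  \sum_(T' <- subtrees T) g T' =
  \sum_(m < n) \sum_(T' <- level X m | interior T' `<=` interior T) g T'.
Proof.
move=> cT.
transitivity (\sum_(T' <- subtrees T)
    \sum_(m < n | #|` interior T'| == m) g T').
  apply: eq_big_seq => T'; rewrite in_subtrees => /fproper_ltn_card.
  by rewrite cT => lt_n; rewrite (big_pred1 (Ordinal lt_n)).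
rewrite (exchange_big_dep xpredT) //=; apply: eq_bigr => m _.
rewrite -big_filter -[RHS]big_filter; apply/perm_big/uniq_perm.
- by rewrite filter_uniq ?fset_uniq.
- by rewrite filter_uniq ?fset_uniq.
move=> T'; rewrite !mem_filter.
change ((#|` interior T'| == m) && (T' \in subtrees T) =
        (interior T' `<=` interior T) && (T' \in level X m)).
rewrite in_subtrees in_level andbC.
case: eqP => [cm|]; last by rewrite !andbF.
rewrite !andbT /tree_lt fproperEneq andb_idl // => sub.
by apply/eqP => TT'; move: (ltn_ord m); rewrite -cm -cT TT' ltnn.
Qed.

(** After the two sums are exchanged, the trees containing a fixed [T'] contribute [subtree_sum],
    which sees [T'] only through its numbers of interior vertices and leaves; both are determined by
    the level. *)
Lemma level_sum_rec f n : tree_recursion f ->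
  \sum_(T <- level X n) f T =
  q ^+ (#|X| * n) * forest_sum n 1 0
  - \sum_(m < n) (\sum_(T' <- level X m) f T')
      * forest_sum (n - m) ((#|X| * m).+1 - m) 0.
Proof.
move=> fE; under eq_bigr do rewrite fE.
rewrite big_split /= sumrN; congr (_ - _).
  (* The leading term is the sum over all trees containing the one-vertex tree, whose interior is
     empty. *)
  have [//|T0 T0I] := fft_of_interior hX (I := fset0).
  have := @subtree_sum T0 n; rewrite T0I cardfs0 => /(_ isT).
  rewrite card_leaves // card_vertices T0I cardfs0 muln0 !subn0 => <-.
  rewrite mulr_sumr big_seq_cond [RHS]big_seq_cond.
  apply: eq_big => [T|T]; rewrite ?fsub0set //= in_level => /andP[/eqP cT _].
  by rewrite card_vertices cT fsetD0.
rewrite big_seq_cond.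
under eq_bigr => T.
  rewrite andbT in_level => /eqP cT.
  rewrite (subtrees_by_level _ cT); over.
rewrite -big_seq_cond exchange_big /=; apply: eq_bigr => m _.
rewrite (exchange_big_dep xpredT) //= mulr_suml.
apply: eq_big_seq => T'; rewrite in_level => /eqP cT'.
rewrite -mulr_sumr subtree_sum ?cT' ?(ltnW (ltn_ord m)) //.
by rewrite card_leaves // card_vertices cT'.
Qed.

End Forests.

(** The recursion of [level_sum_rec] on the level sums does not mention the order. *)
Lemma level_sum_eq (X : finType) (q : int) (lt1 lt2 : rel (seq X))
    (f1 f2 : fft X -> int) : (0 < #|X|)%N ->
    word_order lt1 -> word_order lt2 ->
    tree_recursion q lt1 f1 -> tree_recursion q lt2 f2 ->
  forall n, \sum_(T <- level X n) f1 T = \sum_(T <- level X n) f2 T.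
Proof.
move=> hX lt1P lt2P f1E f2E; elim/ltn_ind => n IHn.
rewrite (level_sum_rec hX lt1P _ f1E) (level_sum_rec hX lt2P _ f2E).
by congr (_ - _); apply: eq_bigr => m _; rewrite IHn.
Qed.

(** * Spans and dimension *)

Section LinearAlgebra.
Variables (K : fieldType) (E : lmodType K).
Implicit Types (S V : set E) (u v : E).

Definition subspace V : Prop :=
  V 0 /\ forall a u v, V u -> V v -> V (a *: u + v).

Lemma subspace_lspan S : subspace (lspan S).
Proof.
split; first by exists 0%N, (fun=> 0), (fun=> 0); rewrite big_ord0; split=> // -[].
move=> a _ _ [m [s [c [sS ->]]]] [n [t [e [tS ->]]]].
exists (m + n)%N,
  (fun i => match fintype.split i with inl j => s j | inr j => t j end),
  (fun i => match fintype.split i with inl j => a * c j | inr j => e j end).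
split; first by move=> i; case: (fintype.split i).
rewrite big_split_ord /= scaler_sumr; congr (_ + _); apply: eq_bigr => i _.
  by rewrite (unsplitK (inl i)) scalerA.
by rewrite (unsplitK (inr i)).
Qed.

Lemma subspaceZ V a u : subspace V -> V u -> V (a *: u).
Proof. by move=> [V0 VD] uV; rewrite -[_ *: _]addr0; exact: VD. Qed.

Lemma subspaceD V u v : subspace V -> V u -> V v -> V (u + v).
Proof. by move=> [V0 VD] uV vV; rewrite -[u]scale1r; exact: VD. Qed.

Lemma subspace_sum V (I : Type) (r : seq I) (P : pred I) (F : I -> E) :
  subspace V -> (forall i, P i -> V (F i)) -> V (\sum_(i <- r | P i) F i).
Proof.
move=> Vsub FV; elim: r => [|i r IHr]; first by rewrite big_nil; case: Vsub.
by rewrite big_cons; case: ifP => // /FV Fi; exact: subspaceD.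
Qed.

Lemma lspan_gen S v : S v -> lspan S v.
Proof.
by move=> Sv; exists 1%N, (fun=> v), (fun=> 1); rewrite big_ord1 scale1r.
Qed.

Lemma lspan_min S V : subspace V -> S `<=` V -> lspan S `<=` V.
Proof.
by move=> Vsub SV _ [n [s [c [sS ->]]]]; apply: subspace_sum => // i _; apply: subspaceZ => //; exact: SV.
Qed.

Lemma lspan_mono S S' : S `<=` S' -> lspan S `<=` lspan S'.
Proof.
move=> SS'; apply: lspan_min; first exact: subspace_lspan.
by move=> v /SS'; exact: lspan_gen.
Qed.

Lemma lspan_range (J : finType) (s : J -> E) v :
  lspan (range s) v -> exists c : J -> K, v = \sum_j c j *: s j.
Proof.
move: v; apply: (@lspan_min _ [set v | exists c : J -> K, v = \sum_j c j *: s j]).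
  split; first by exists (fun=> 0); rewrite big1 // => j _; rewrite scale0r.
  move=> a _ _ [c ->] [e ->]; exists (fun j => a * c j + e j).
  rewrite scaler_sumr -big_split; apply: eq_bigr => j _ /=.
  by rewrite scalerDl scalerA.
move=> _ [j _ <-]; exists (fun i => (i == j)%:R); rewrite (bigD1 j) //= eqxx scale1r big1 ?addr0 //.
by move=> i /negPf ->; rewrite scale0r.
Qed.

(** Independence of [b] makes the left kernel of the coefficient matrix trivial, so its rank [m] is
    at most its number [n] of columns. *)
Lemma lin_indep_leq m n (b : 'I_m -> E) (s : 'I_n -> E) :
  lin_indep b -> (forall i, lspan (range s) (b i)) -> (m <= n)%N.
Proof.
move=> bfree bs; have /choice[C bC] i := lspan_range (bs i).
pose M := \matrix_(i < m, j < n) C i j.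
suff /eqP <- : row_free M by exact: rank_leq_col.
rewrite -kermx_eq0; apply/eqP/row_matrixP => i; rewrite row0.
set r := row i _; have rM : r *m M = 0.
  by apply/sub_kermxP; exact: row_sub.
apply/rowP => j; rewrite [RHS]mxE; move: j; apply: bfree.
under eq_bigr do rewrite bC scaler_sumr.
rewrite exchange_big big1 //= => j _.
have rMj : \sum_i r 0 i * C i j = 0.
  transitivity ((r *m M) 0 j); last by rewrite rM mxE.
  by rewrite mxE; apply: eq_bigr => k _; rewrite [M _ _]mxE.
under eq_bigr do rewrite scalerA.
by rewrite -scaler_suml rMj scale0r.
Qed.

Lemma dimensionE V n : has_dim V n -> dimension V = n.
Proof.
have leq m p : has_dim V m -> has_dim V p -> (m <= p)%N.
  move=> [b [bfree bV]] [s [_ sV]]; apply: (lin_indep_leq (s := s) bfree) => i.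
  by rewrite sV -bV; apply: lspan_gen; exists i.
move=> Vn; rewrite /dimension; apply: xget_unique => //= m Vm.
by apply/eqP; rewrite eqn_leq !leq.
Qed.

End LinearAlgebra.

Lemma subspace_preim (K : fieldType) (E E' : lmodType K) (f : E -> E') (V : set E') :
  linear f -> subspace V -> subspace (f @^-1` V).
Proof.
move=> fl [V0 VD]; split=> [|a u v] /=; last by rewrite fl; exact: VD.
by have := fl (-1) 0 0; rewrite scaleN1r oppr0 addr0 scaleN1r addNr => ->.
Qed.

(** * A word order compatible with left multiplication *)

Section WordValue.
Variable X : finType.
Hypothesis hX : (0 < #|X|)%N.

(* Bijective base-#|X| numeration; unlike the lexicographic order it satisfies
   both [w < x :: w] and [u < w -> x :: u < x :: w]. *)
Definition wval : seq X -> nat :=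
  foldr (fun x n => (#|X| * n + (enum_rank x).+1)%N) 0%N.

Lemma wval_cons x w : (wval w < wval (x :: w))%N.
Proof. by rewrite /= addnS ltnS (leq_trans (leq_pmull _ hX)) ?leq_addr. Qed.

Lemma wval_cons_mono x u w : (wval u < wval w)%N ->
  (wval (x :: u) < wval (x :: w))%N.
Proof. by move=> uw; rewrite /= ltn_add2r ltn_pmul2l. Qed.

Lemma wval_inj : injective wval.
Proof.
elim=> [|x u IHu] [|y w] //=; rewrite ?addnS // => -[] E.
(* Digits run from 1 to [#|X|]; once the successor is cancelled, the rank of the first letter is a
   remainder modulo [#|X|]. *)
have modE (z : X) n : ((#|X| * n + enum_rank z) %% #|X| = enum_rank z)%N.
  by rewrite mulnC modnMDl modn_small ?ltn_ord.
have xy : x = y.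
  by apply: enum_rank_inj; apply: val_inj; rewrite /= -(modE x (wval u)) E modE.
move: E; rewrite xy => /addIn /eqP; rewrite eqn_pmul2l // => /eqP /IHu ->.
by [].
Qed.

Lemma wval_order : word_order (fun u w => wval u < wval w)%N.
Proof.
split=> [u|u v w|u w uw|x w]; first exact: ltnn.
- exact: ltn_trans.
- by rewrite -neq_ltn (contra_neq (@wval_inj u w)).
exact: wval_cons.
Qed.

End WordValue.

(** * Pivots *)

Section Pivots.
Variables (K : fieldType) (E : lmodType K) (X : finType).
Hypothesis hX : (0 < #|X|)%N.
Variables (v : seq X -> E) (op : X -> E -> E).
Hypothesis op_lin : forall x, linear (op x).
Hypothesis opE : forall x w, op x (v w) = v (x :: w).

Definition lower (w : seq X) : set (seq X) :=
  [set u | (wval u < wval w)%N].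

(** The words at which an echelon reduction of the family [v], taken in increasing [wval], meets a
    new direction. *)
Definition pivot (w : seq X) : bool := `[< ~ lspan (v @` lower w) (v w) >].

Lemma pivotP w : reflect (~ lspan (v @` lower w) (v w)) (pivot w).
Proof. exact: asboolP. Qed.

Lemma npivotP w : reflect (lspan (v @` lower w) (v w)) (~~ pivot w).
Proof.
apply: (iffP idP) => [/pivotP/contrapT //|H].
by apply/pivotP => /(_ H).
Qed.

(** Compatibility of the order with left multiplication enters here: [op x] carries words before [w]
    to words before [x :: w]. A dependence at [w] thus propagates to [x :: w]. *)
Lemma lower_cons (x : X) (w : seq X) :
  lspan (v @` lower w) `<=` op x @^-1` lspan (v @` lower (x :: w)).
Proof.
apply: lspan_min; first exact/subspace_preim/subspace_lspan.
move=> _ [u uw <-] /=; rewrite opE; apply: lspan_gen.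
by exists (x :: u) => //; exact: wval_cons_mono.
Qed.

Lemma pivot_behead x w : pivot (x :: w) -> pivot w.
Proof.
apply: contraTT => /npivotP /(@lower_cons x w) /=.
by rewrite opE => /npivotP.
Qed.

Lemma pivot_suffix u w : pivot (u ++ w) -> pivot w.
Proof. by elim: u => //= x u IHu /pivot_behead. Qed.

(** The largest word with a non-zero coefficient would depend on smaller ones and so would not be a
    pivot. *)
Lemma pivot_free (B : {fset seq X}) (c : seq X -> K) :
    {in B, forall w, pivot w} -> \sum_(w <- B) c w *: v w = 0 ->
  {in B, forall w, c w = 0}.
Proof.
(* [N] exceeds all values on [B], so the induction on [n] below treats the words of [B] from the
   largest down. *)
move=> Bp sum0; pose N := (\max_(w <- B) wval w).+1.
have down n : {in B, forall w, (N <= wval w + n)%N -> c w = 0}.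
  elim: n => [|n IHn] w wB; first by rewrite addn0 ltnNge leq_bigmax_seq.
  move=> Nw; apply/eqP; apply: contraT => cw; have /pivotP[] := Bp w wB.
  have : c w *: v w = \sum_(u <- B | u != w) - c u *: v u.
    apply/eqP; rewrite -subr_eq0 -sumrN -[X in _ == X]sum0 (bigD1_seq w) //=.
    by apply/eqP; congr (_ + _); apply: eq_bigr => u _; rewrite scaleNr opprK.
  move/(congr1 (fun u => (c w)^-1 *: u)); rewrite scalerA mulVf // scale1r => ->.
  apply: subspaceZ; first exact: subspace_lspan.
  rewrite big_seq_cond; apply: subspace_sum; first exact: subspace_lspan.
  move=> u /andP[uB uw].
  have [wu|uw'|E0] := ltngtP (wval w) (wval u).
  - rewrite IHn // ?oppr0 ?scale0r; first exact: (subspace_lspan _).1.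
    by rewrite (leq_trans Nw) // addnS -addSn leq_add2r.
  - apply: subspaceZ; first exact: subspace_lspan.
    by apply: lspan_gen; exists u.
  by rewrite (wval_inj hX E0) eqxx in uw.
by move=> w wB; apply: (down N) => //; rewrite leq_addl.
Qed.

Lemma pivot_span_lt n w : (wval w < n)%N ->
  lspan (v @` [set u | pivot u /\ (wval u < n)%N]) (v w).
Proof.
elim/ltn_ind: n w => n IHn w wn.
have [pw|/npivotP] := boolP (pivot w); first by apply: lspan_gen; exists w.
apply: lspan_min; first exact: subspace_lspan.
move=> _ [u uw <-]; apply: lspan_mono (IHn _ wn u uw).
by move=> _ [z [pz zw] <-]; exists z => //; split=> //; exact: ltn_trans wn.
Qed.

Lemma pivot_span w : lspan (v @` [set u | pivot u]) (v w).
Proof.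
apply: lspan_mono (pivot_span_lt (ltnSn _)) => _ [u [pu _] <-].
by exists u.
Qed.

Lemma npivot_span w : ~~ pivot w ->
  lspan (v @` [set u | pivot u /\ (wval u < wval w)%N]) (v w).
Proof.
move/npivotP; apply: lspan_min; first exact: subspace_lspan.
by move=> _ [u uw <-]; exact: pivot_span_lt.
Qed.

Lemma pivot_bounded n (s : 'I_n -> E) (B : {fset seq X}) :
    (forall w, lspan (range s) (v w)) -> {in B, forall w, pivot w} ->
  (#|` B| <= n)%N.
Proof.
move=> vs Bp; pose b (i : 'I_(#|` B|%fset)) := v (nth [::] B i).
apply: (@lin_indep_leq _ _ _ _ b s) => [c sum0 i|i]; last exact: vs.
have iB (j : 'I_(#|` B|%fset)) : nth [::] B j \in B by apply: mem_nth.
pose i0 : 'I_(#|` B|%fset) := i.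
(* Coefficients are moved from positions to words; [i0] is a placeholder for words outside [B]. *)
pose c' w := c (insubd i0 (index w B)).
have c'E (j : 'I_(#|` B|%fset)) : c' (nth [::] B j) = c j.
  rewrite /c' index_uniq ?fset_uniq //; congr c; apply: val_inj.
  by rewrite val_insubd ltn_ord.
rewrite -c'E; apply: (pivot_free Bp); last exact: iB.
rewrite (big_nth [::]) big_mkord -[RHS]sum0; apply: eq_bigr => j _.
by rewrite c'E.
Qed.

(** More than [n] pivots would give too many independent vectors in a space with [n] generators.
    Closure under removal of the first letter then makes the pivots the interior of a tree. *)
Lemma pivot_finite n (s : 'I_n -> E) : (forall w, lspan (range s) (v w)) ->
  exists T : fft X, forall w, pivot w = (w \in interior T).
Proof.
move=> vs.
have fin : finite_set [set w | pivot w].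
  apply: contrapT => /(@infinite_set_fset _ _ n.+1)[B Bp]; apply/negP.
  by rewrite -leqNgt; apply: pivot_bounded vs _ => w /Bp.
have mem w : (w \in fset_set [set w | pivot w]) = pivot w.
  by rewrite in_fset_set //; apply: asboolb.
have [|T TE] := fft_of_interior hX (I := fset_set [set w | pivot w]).
  by move=> x w; rewrite !mem; exact: pivot_behead.
by exists T => w; rewrite TE mem.
Qed.

End Pivots.

(** * Series modulo constants *)

Section SeriesFacts.
Variables (K : fieldType) (X : finType).
Local Notation S := (series K X).
Implicit Types (A B C : S) (w u t : seq X) (x y : X) (a : K).

(* The class of a series modulo the constants. *)
Definition cut A : S := fun w => if w is [::] then 0 else A w.

Definition shift x A : S := cut (rho [:: x] A).

Definition tails A w : S := cut (rho w A).

Lemma rho_linear t : linear (@rho K X t).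
Proof. by []. Qed.

Lemma rho_cat u w A : rho u (rho w A) = rho (u ++ w) A.
Proof. by apply/funext => t; rewrite /rho catA. Qed.

Lemma rho1 x : rho [:: x] (1 : S) = 0.
Proof. by apply/funext => -[]. Qed.

Lemma rho_letter x y : rho [:: y] (letter K x) = (x == y)%:R *: (1 : S).
Proof.
apply/funext => w; rewrite series_scaleE /rho /letter.
rewrite /GRing.one /= /series_one.
case: w => [|z w]; first by rewrite /= eqseq_cons andbT mulr1 eq_sym.
by rewrite mulr0 eqseq_cons; case: w => [|? ?]; rewrite andbF.
Qed.

(** In a factorisation of [w] followed by [x], the letter [x] ends the second factor, unless that
    factor is empty. *)
Lemma rho_mul x A B :
  rho [:: x] (A * B) = A * rho [:: x] B + epsilon B *: rho [:: x] A.
Proof.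
apply/funext => w; rewrite series_addE series_scaleE /rho /GRing.mul /=.
rewrite /series_mul size_cat addn1 big_ord_recr /=.
rewrite take_oversize ?drop_oversize ?size_cat ?addn1 //.
congr (_ + _); last exact: mulrC.
apply: eq_bigr => i _.
have iw : (i <= size w)%N by rewrite -ltnS ltn_ord.
rewrite takel_cat // drop_cat; have [//|wi] := ltnP i (size w).
have -> : nat_of_ord i = size w by apply/eqP; rewrite eqn_leq iw.
by rewrite subnn drop0 drop_size.
Qed.

Lemma series_decomp A :
  A = epsilon A *: 1 + \sum_(x : X) rho [:: x] A * letter K x.
Proof.
apply/funext => w; rewrite series_addE series_scaleE.
have -> : (\sum_(x : X) rho [:: x] A * letter K x) w =
          \sum_(x : X) (rho [:: x] A * letter K x) w.
  by elim/big_rec2: _ => // x y1 y2 _ <-.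
case/lastP: w => [|w y].
  rewrite mulr1 big1 ?addr0 // => x _.
  by rewrite /GRing.mul /= series_mul_nil mulr0.
rewrite -cats1 (_ : (1 : S) _ = 0) ?mulr0 ?add0r; last by case: w.
rewrite (bigD1 y) //= big1 ?addr0 => [|x xy];
  rewrite -[(_ * _ : S) _]/(rho [:: y] _ w) rho_mul series_addE series_scaleE;
  rewrite mul0r addr0 rho_letter -scalerAr mulr1 ?eqxx ?scale1r //.
by rewrite (negPf xy) scale0r.
Qed.

Lemma cut_linear : linear cut.
Proof.
move=> a A B; apply/funext => -[|x w] //.
by rewrite series_addE series_scaleE /= mulr0 addr0.
Qed.

Lemma shift_linear x : linear (shift x).
Proof. by move=> a A B; rewrite /shift rho_linear cut_linear. Qed.

(** [rho [:: x]] never reads the constant coefficient, so it acts on classes modulo constants. *)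
Lemma shift_tails x w A : shift x (tails A w) = tails A (x :: w).
Proof.
apply/funext => -[|y u] //=; rewrite /tails /cut /rho /=.
by rewrite -catA.
Qed.

Lemma cut_eq0 A : cut A = 0 -> A = epsilon A *: 1.
Proof.
move=> A0; apply/funext => w; rewrite series_scaleE.
case: w => [|x w]; first by rewrite mulr1.
by rewrite mulr0 -[RHS]/((0 : S) (x :: w)) -A0.
Qed.

Lemma cut1 : cut 1 = 0.
Proof. by apply/funext => -[]. Qed.

End SeriesFacts.

(** * The norm as the number of pivots *)

Section Norm.
Variables (K : fieldType) (X : finType).
Hypothesis hX : (0 < #|X|)%N.
Local Notation S := (series K X).
Variables (A : S) (T : fft X).
Hypothesis AT : forall w, pivot (tails A) w = (w \in interior T).
Local Notation I := (enum_fset (interior T)).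

(** A basis of the closure of [A] plus the constants: the series 1 at index 0, then one [rho w A]
    for each pivot [w]. The extra vector accounts for the predecessor in [norm]. *)
Definition pivot_basis (i : 'I_(size I).+1) : S :=
  if unlift ord0 i is Some j then rho (nth [::] I j) A else 1.

Lemma pivot_basis_free : lin_indep pivot_basis.
Proof.
have cl := @cut_linear K X; have cut_sum n (c : 'I_n -> K) (s : 'I_n -> S) :
    cut (\sum_i c i *: s i) = \sum_i c i *: cut (s i).
  elim: n c s => [|n IHn] c s; last by rewrite !big_ord_recl cl IHn.
  by rewrite !big_ord0; apply/funext => -[].
move=> c; rewrite big_ord_recl {1}/pivot_basis unlift_none => sum0.
(* Modulo constants only the pivots remain, and they are free. Since index 0 belongs to the
   constant, the coefficient of a word sits one place after its position. *)
have cI : {in interior T, forall w,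
    c (inord (index w I).+1) = 0}.
  apply: (@pivot_free _ _ _ hX (tails A)) => [w|]; first by rewrite AT.
  have := congr1 (@cut K X) sum0; rewrite cl cut1 scaler0 add0r cut_sum.
  have -> : cut 0 = 0 :> S by apply/funext => -[].
  move=> cs0; rewrite -[RHS]cs0 (big_nth [::]) big_mkord.
  apply: eq_bigr => j _.
  rewrite index_uniq ?fset_uniq // /pivot_basis liftK; congr (c _ *: _).
  by apply: val_inj; rewrite /= inordK // ltnS.
have clift j : c (lift ord0 j) = 0.
  rewrite -(cI (nth [::] I j)); last exact: mem_nth.
  congr c; apply: val_inj; rewrite index_uniq ?fset_uniq //=.
  by rewrite inordK // ltnS.
move=> i; case: (unliftP ord0 i) => [j ->|->]; first exact: clift.
move: sum0; rewrite big1 ?addr0; last by move=> j _; rewrite clift scale0r.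
by move/(congr1 (fun B : S => B [::])); rewrite series_scaleE mulr1.
Qed.

(** Modulo constants this is [pivot_span]; the constant lost by [cut] is restored by the first basis
    vector. *)
Lemma rho_pivot_basis w : lspan (range pivot_basis) (rho w A).
Proof.
have Bsub := subspace_lspan (range pivot_basis).
have one_in : lspan (range pivot_basis) 1.
  by apply: lspan_gen; exists ord0; rewrite // /pivot_basis unlift_none.
pose Q := [set B : S | exists2 C, lspan (range pivot_basis) C & cut C = B].
have Qsub : subspace Q.
  split=> [|a _ _ [B BB <-] [C CB <-]].
    by exists 0; [exact: Bsub.1|apply/funext => -[]].
  by exists (a *: B + C); [exact: Bsub.2|exact: cut_linear].
have QI : tails A @` [set u | pivot (tails A) u] `<=` Q.
  move=> _ [u pu <-]; exists (rho u A) => //; apply: lspan_gen.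
  have uI : u \in I by rewrite -[_ \in I]/(u \in interior T) -AT.
  have lt_u : (index u I < size I)%N by rewrite index_mem.
  exists (lift ord0 (Ordinal lt_u)) => //.
  by rewrite /pivot_basis liftK nth_index.
have [C CB CE] := lspan_min Qsub QI (pivot_span (tails A) w).
have : cut (rho w A - C) = 0.
  by rewrite addrC -scaleN1r cut_linear scaleN1r CE addNr.
move/cut_eq0 => /(congr1 (fun B => B + C)); rewrite subrK => ->.
exact: Bsub.2.
Qed.

Lemma norm_pivot : norm A = #|` interior T|%fset.
Proof.
rewrite /norm; set V := (X in dimension X).
suff /dimensionE -> : has_dim V (size I).+1 by [].
exists pivot_basis; split; first exact: pivot_basis_free.
have Bsub := subspace_lspan (range pivot_basis).
apply/seteqP; split.
  apply: lspan_min.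
    have Rsub := subspace_lspan [set rho t A | t in setT].
    split; first by exists 0; [exact: Rsub.1|exists 0; [exists 0; rewrite ?scale0r|rewrite addr0]].
    move=> a _ _ [B BR [_ [b _ <-] <-]] [C CR [_ [c _ <-] <-]].
    exists (a *: B + C); first exact: Rsub.2.
    exists ((a * b + c)%:A); first by exists (a * b + c).
    by rewrite scalerDl -scalerA scalerDr addrACA.
  move=> _ [i _ <-]; rewrite /pivot_basis; case: unlift => [j|].
    exists (rho (nth [::] I j) A); first by apply: lspan_gen; exists (nth [::] I j).
    by exists 0; [exists 0; rewrite ?scale0r|rewrite addr0].
  exists 0; first exact: (subspace_lspan _).1.
  by exists 1; [exists 1; rewrite ?scale1r|rewrite add0r].
move=> _ [B BR [_ [c _ <-] <-]]; rewrite addrC; apply: Bsub.2.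
  by apply: lspan_gen; exists ord0; rewrite // /pivot_basis unlift_none.
by apply: lspan_min BR => // _ [t _ <-]; exact: rho_pivot_basis.
Qed.

End Norm.

(** * Rationality *)

Section Rationality.
Variables (K : fieldType) (X : finType).
Local Notation S := (series K X).
Implicit Types (A B C : S) (w u t : seq X) (x y : X) (a : K).

(** Membership in a finite-dimensional space stable under every [rho [:: x]]. The generators need
    not be free, so closure properties follow by listing generators. *)
Definition recognizable A : Prop := exists (J : finType) (s : J -> S),
  lspan (range s) A /\ forall j x, lspan (range s) (rho [:: x] (s j)).

Lemma lspan_comap (f : S -> S) (W V : set S) B : linear f -> subspace V ->
  (forall C, W C -> V (f C)) -> lspan W B -> V (f B).
Proof.
move=> fl Vsub WV; apply: (@lspan_min _ _ W (f @^-1` V)) => //.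
exact: subspace_preim.
Qed.

Lemma recognizable_letter x : recognizable (letter K x).
Proof.
exists bool, (fun b => if b then letter K x else 1); split.
  by apply: lspan_gen; exists true.
have Vsub := subspace_lspan (range (fun b => if b then letter K x else 1)).
move=> [] y; last by rewrite rho1; exact: Vsub.1.
rewrite rho_letter; apply: subspaceZ => //.
by apply: lspan_gen; exists false.
Qed.

Lemma recognizable1 : recognizable 1.
Proof.
exists unit, (fun=> 1); split; first by apply: lspan_gen; exists tt.
by move=> _ x; rewrite rho1; exact: (subspace_lspan _).1.
Qed.

Definition sum_family (J1 J2 : finType) (s1 : J1 -> S) (s2 : J2 -> S) :
  J1 + J2 -> S := fun k => match k with inl j => s1 j | inr j => s2 j end.

Lemma sum_familyl (J1 J2 : finType) (s1 : J1 -> S) (s2 : J2 -> S) :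
  lspan (range s1) `<=` lspan (range (sum_family s1 s2)).
Proof. by apply: lspan_mono => _ [j _ <-]; exists (inl j). Qed.

Lemma sum_familyr (J1 J2 : finType) (s1 : J1 -> S) (s2 : J2 -> S) :
  lspan (range s2) `<=` lspan (range (sum_family s1 s2)).
Proof. by apply: lspan_mono => _ [j _ <-]; exists (inr j). Qed.

Lemma recognizableD a A B : recognizable A -> recognizable B ->
  recognizable (a *: A + B).
Proof.
move=> [J1 [s1 [As1 s1P]]] [J2 [s2 [Bs2 s2P]]].
have Vsub := subspace_lspan (range (sum_family s1 s2)).
exists (J1 + J2)%type, (sum_family s1 s2); split.
  by apply: Vsub.2; [exact: sum_familyl|exact: sum_familyr].
by move=> [] j x; [apply: sum_familyl; exact: s1P|apply: sum_familyr; exact: s2P].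
Qed.

Lemma mul_linear A : linear (fun B => A * B : S).
Proof. by move=> a B C; rewrite mulrDr scalerAr. Qed.

Lemma rho_span (J : finType) (s : J -> S) x :
    (forall j, lspan (range s) (rho [:: x] (s j))) ->
  forall A, lspan (range s) A -> lspan (range s) (rho [:: x] A).
Proof.
move=> sP A; apply: lspan_comap; [exact: rho_linear|exact: subspace_lspan|].
by move=> _ [j _ <-].
Qed.

(** By [rho_mul], the generators for [A] together with the products of [A] with those for [B] span a
    stable space. *)
Lemma recognizableM A B : recognizable A -> recognizable B ->
  recognizable (A * B).
Proof.
move=> [J1 [s1 [As1 s1P]]] [J2 [s2 [Bs2 s2P]]].
pose s := sum_family s1 (fun j => A * s2 j).
have Vsub := subspace_lspan (range s).
have mulA C : lspan (range s2) C -> lspan (range s) (A * C).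
  apply: lspan_comap => //; first exact: mul_linear.
  by move=> _ [j _ <-]; apply: sum_familyr; apply: lspan_gen; exists j.
exists (J1 + J2)%type, s; split; first exact: mulA.
move=> [] j x; first by apply: sum_familyl; exact: s1P.
rewrite /= rho_mul addrC; apply: Vsub.2; last exact/mulA.
by apply: sum_familyl; exact: rho_span.
Qed.

(** Applying [rho [:: x]] to [A * B = 1] and multiplying by [B] gives [rho [:: x] B = - epsilon B *:
    (B * rho [:: x] A)]. So [B] and the products [B * s1 j] span a stable space. *)
Lemma recognizableV A B : recognizable A -> A * B = 1 -> B * A = 1 ->
  recognizable B.
Proof.
move=> [J1 [s1 [As1 s1P]]] AB BA.
pose s := sum_family (fun=> B : S) (fun j => B * s1 j) : unit + J1 -> S.
have Vsub := subspace_lspan (range s).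
have mulB C : lspan (range s1) C -> lspan (range s) (B * C).
  apply: lspan_comap => //; first exact: mul_linear.
  by move=> _ [j _ <-]; apply: sum_familyr; apply: lspan_gen; exists j.
have rhoB x : lspan (range s) (rho [:: x] B).
  have : rho [:: x] (A * B) = 0 by rewrite AB rho1.
  rewrite rho_mul => /(congr1 (fun C => B * C)).
  rewrite mulr0 mulrDr mulrA BA mul1r -scalerAr => /eqP; rewrite addr_eq0.
  move=> /eqP ->; rewrite -scaleNr; apply: subspaceZ => //.
  by apply: mulB; exact: rho_span.
exists (unit + J1)%type, s; split.
  by apply: sum_familyl; apply: lspan_gen; exists tt.
move=> [] j x; first exact: rhoB.
by rewrite /= rho_mul addrC; apply: Vsub.2 => //; exact: mulB.
Qed.

Lemma rational_recognizable A : rational A -> recognizable A.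
Proof.
apply; split; last by move=> _ [x _ <-]; exact: recognizable_letter.
split; last by move=> B C; exact: recognizableV.
split; first by rewrite -topredE /=; apply/asboolP; exact: recognizable1.
  move=> a B C; rewrite -!topredE /= => /asboolP rB /asboolP rC.
  by apply/asboolP; exact: recognizableD.
move=> B C; rewrite -!topredE /= => /asboolP rB /asboolP rC.
by apply/asboolP; exact: recognizableM.
Qed.

Lemma rational_letter x : rational (letter K x).
Proof. by move=> R [_ RX]; apply: RX; exists x. Qed.

Lemma rational1 : rational (1 : S).
Proof. by move=> R [[[+ _ _] _] _]; rewrite -topredE /= => /asboolP. Qed.

Lemma rationalD a A B : rational A -> rational B -> rational (a *: A + B).
Proof.
move=> rA rB R RP; have [[[_ + _] _] _] := RP => /(_ a A B).
rewrite -!topredE /= => H; apply/asboolP/H; apply/asboolP; [exact: rA|exact: rB].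
Qed.

Lemma rationalM A B : rational A -> rational B -> rational (A * B).
Proof.
move=> rA rB R RP; have [[[_ _ +] _] _] := RP => /(_ A B).
rewrite -!topredE /= => H; apply/asboolP/H; apply/asboolP; [exact: rA|exact: rB].
Qed.

Lemma rationalV A B : rational A -> A * B = 1 -> B * A = 1 -> rational B.
Proof. by move=> rA AB BA R RP; apply: RP.1.2 AB BA; exact: rA. Qed.

Lemma subspace_rational : subspace (@rational K X).
Proof.
split=> [|a A B]; last exact: rationalD.
by rewrite -[0](addNr 1) -scaleN1r; apply: rationalD; exact: rational1.
Qed.

Lemma mul_local A B A' B' w :
    (forall u, (size u <= size w)%N -> A u = A' u) ->
    (forall u, (size u <= size w)%N -> B u = B' u) ->
  (A * B) w = (A' * B') w.
Proof.
move=> AA' BB'; rewrite /GRing.mul /= /series_mul; apply: eq_bigr => i _.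
rewrite AA' ?BB' // ?size_drop ?leq_subr //.
by rewrite size_take; case: ifP => // /ltnW.
Qed.

Lemma exp_small (P : S) n w : epsilon P = 0 -> (size w < n)%N -> (P ^+ n) w = 0.
Proof.
move=> P0; have {}P0 : P [::] = 0 := P0; elim: n w => // n IHn w wn.
rewrite exprS /GRing.mul /= /series_mul big1 // => i _.
have [i0|i0] := posnP i; first by rewrite i0 take0 P0 mul0r.
rewrite IHn ?mulr0 // size_drop -ltnS (leq_trans _ wn) // !ltnS.
rewrite ltn_subrL i0 (leq_trans i0) //.
by rewrite -ltnS ltn_ord.
Qed.

Definition geometric (P : S) n : S := \sum_(i < n) P ^+ i.

Lemma geometric_stable (P : S) m n w : epsilon P = 0 ->
  (size w < m)%N -> (m <= n)%N -> geometric P n w = geometric P m w.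
Proof.
move=> P0 wm; elim: n => [|n IHn]; first by rewrite leqn0 => /eqP ->.
rewrite leq_eqVlt => /orP[/eqP -> //|]; rewrite ltnS => mn.
rewrite /geometric big_ord_recr /= series_addE -/(geometric P n) IHn //.
by rewrite exp_small ?addr0 // (leq_trans wm).
Qed.

Lemma mul_geometric (P : S) n : (1 - P) * geometric P n = 1 - P ^+ n.
Proof.
elim: n => [|n IHn]; first by rewrite /geometric big_ord0 mulr0 expr0 subrr.
rewrite /geometric big_ord_recr /= mulrDr -/(geometric P n) IHn mulrBl mul1r.
by rewrite -exprS addrA subrK.
Qed.

Lemma geometric_mul (P : S) n : geometric P n * (1 - P) = 1 - P ^+ n.
Proof.
elim: n => [|n IHn]; first by rewrite /geometric big_ord0 mul0r expr0 subrr.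
rewrite /geometric big_ord_recr /= mulrDl -/(geometric P n) IHn mulrBr mulr1.
by rewrite -exprSr addrA subrK.
Qed.

Lemma inverse_exists (P : S) : epsilon P = 0 ->
  exists B : S, (1 - P) * B = 1 /\ B * (1 - P) = 1.
Proof.
(* The coefficient at [w] is read from a partial geometric sum long enough that further terms no
   longer change it. *)
move=> P0; exists (fun w => geometric P (size w).+1 w).
have geoE w u : (size u <= size w)%N ->
    geometric P (size u).+1 u = geometric P (size w).+1 u.
  by move=> uw; rewrite (@geometric_stable P (size u).+1 (size w).+1).
have small w : (1 - P ^+ (size w).+1) w = (1 : S) w.
  by rewrite series_addE -[(- _) w]/(- (_ w)) exp_small // subr0.
split; apply/funext => w; rewrite -small.
  by rewrite -mul_geometric; apply: mul_local => // u; exact: geoE.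
by rewrite -geometric_mul; apply: mul_local => // u; exact: geoE.
Qed.

(** Gaussian elimination over a non-commutative ring. The unknowns stand on the left, so the first
    equation is solved by multiplying on the right by the inverse of [1 - p ord0 ord0], which exists
    because [p ord0 ord0] has no constant term. *)
Lemma linear_system_rational n (s e : 'I_n -> S) (p : 'I_n -> 'I_n -> S) :
    (forall i, rational (e i)) -> (forall i j, rational (p i j)) ->
    (forall i j, epsilon (p i j) = 0) ->
    (forall i, s i = e i + \sum_j s j * p i j) ->
  forall i, rational (s i).
Proof.
have radd A B : rational A -> rational B -> rational (A + B).
  exact: (subspaceD subspace_rational).
have epsM A B : epsilon (A * B) = epsilon A * epsilon B.
  exact: series_mul_nil.
elim: n s e p => [|n IHn] s e p re rp p0 sE; first by case.
have [q [pq qp]] := inverse_exists (p0 ord0 ord0).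
have rq : rational q.
  apply: rationalV pq qp; rewrite addrC -scaleN1r.
  by apply: rationalD; [exact: rp|exact: rational1].
have s0E : s ord0 = e ord0 * q
    + \sum_j s (lift ord0 j) * (p ord0 (lift ord0 j) * q).
  have := sE ord0; rewrite big_ord_recl addrCA => /eqP.
  rewrite addrC -subr_eq -{1}[s ord0]mulr1 -mulrBr => /eqP.
  move/(congr1 (fun B => B * q)); rewrite -mulrA pq mulr1 => ->.
  rewrite mulrDl mulr_suml; congr (_ + _); apply: eq_bigr => j _.
  by rewrite mulrA.
have rs j : rational (s (lift ord0 j)).
  (* Substituting [s ord0] leaves one unknown fewer, and the new coefficients again have no constant
     term. *)
  move: j; apply: (IHn _ (fun i => e (lift ord0 i)
      + e ord0 * q * p (lift ord0 i) ord0)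
    (fun i j => p ord0 (lift ord0 j) * q * p (lift ord0 i) ord0
      + p (lift ord0 i) (lift ord0 j))).
  - by move=> i; apply: radd => //; do 2?apply: rationalM.
  - by move=> i j; apply: radd => //; do 2?apply: rationalM.
  - move=> i j; rewrite [LHS]series_addE.
    by rewrite -![_ [::]]/(epsilon _) epsM !p0 mulr0 addr0.
  move=> i; rewrite sE big_ord_recl {1}s0E mulrDl !addrA mulr_suml -addrA.
  rewrite -big_split; congr (_ + _); apply: eq_bigr => j _ /=.
  by rewrite mulrDr !mulrA.
move=> i; case: (unliftP ord0 i) => [j ->|->]; first exact: rs.
rewrite s0E; apply: radd; first exact: rationalM.
apply: (subspace_sum _ subspace_rational) => j _.
by apply: rationalM => //; exact: rationalM.
Qed.

(** Sorting words by their last letter turns stability of the span into a linear system for the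
    [s i], with combinations of letters as coefficients. *)
Lemma recognizable_rational n (s : 'I_n -> S) :
    (forall i x, lspan (range s) (rho [:: x] (s i))) ->
  forall A, lspan (range s) A -> rational A.
Proof.
move=> sP; apply: (lspan_min subspace_rational).
have /choice[m mE] (p : 'I_n * X) := lspan_range (sP p.1 p.2).
move=> _ [i _ <-]; move: i.
apply: (@linear_system_rational n s (fun i => epsilon (s i) *: 1)
  (fun i j => \sum_(x : X) m (i, x) j *: letter K x)).
- by move=> i; apply: (subspaceZ _ subspace_rational); exact: rational1.
- move=> i j; apply: (subspace_sum _ subspace_rational) => x _.
  by apply: (subspaceZ _ subspace_rational); exact: rational_letter.
- move=> i j; elim/big_rec: _ => // x B _ B0.
  by rewrite /epsilon series_addE [B _]B0 addr0 series_scaleE mulr0.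
move=> i; rewrite {1}[s i]series_decomp; congr (_ + _).
under eq_bigr => x _ do rewrite (mE (i, x)) mulr_suml.
rewrite exchange_big /=; apply: eq_bigr => j _.
rewrite mulr_sumr; apply: eq_bigr => x _.
by rewrite -scalerAl scalerAr.
Qed.

Lemma rho_recognizable (J : finType) (s : J -> S) A :
    lspan (range s) A -> (forall j x, lspan (range s) (rho [:: x] (s j))) ->
  forall w, lspan (range s) (rho w A).
Proof.
move=> As sP; elim=> [|x w IHw].
  by rewrite (_ : rho [::] A = A) //; apply/funext => w; rewrite /rho cats0.
by rewrite -cat1s -rho_cat; apply: rho_span.
Qed.

End Rationality.

(** * Rationality as finiteness of the set of pivots *)

Section PivotRational.
Variables (K : fieldType) (X : finType).
Hypothesis hX : (0 < #|X|)%N.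
Local Notation S := (series K X).

Lemma rational_pivot (A : S) : rational A ->
  exists T : fft X, forall w, pivot (tails A) w = (w \in interior T).
Proof.
move/rational_recognizable => [J [s [As sP]]].
apply: (@pivot_finite _ _ _ hX (tails A) (@shift K X) _ _ #|J|
  (fun i => cut (s (enum_val i)))).
- by move=> x; exact: shift_linear.
- by move=> x w; exact: shift_tails.
move=> w; apply: lspan_comap (rho_recognizable As sP w).
- exact: cut_linear.
- exact: subspace_lspan.
move=> _ [j _ <-]; apply: lspan_gen; exists (enum_rank j) => //.
by rewrite enum_rankK.
Qed.

Lemma pivot_rational (A : S) (T : fft X) :
  (forall w, pivot (tails A) w = (w \in interior T)) -> rational A.
Proof.
move=> AT; pose b := @pivot_basis K X A T.
apply: (@recognizable_rational _ _ _ b) => [i x|].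
  rewrite /b /pivot_basis; case: unlift => [j|].
    by rewrite rho_cat; exact: rho_pivot_basis.
  by rewrite rho1; exact: (subspace_lspan _).1.
rewrite (_ : A = rho [::] A); first exact: rho_pivot_basis.
by apply/funext => w; rewrite /rho cats0.
Qed.

End PivotRational.

(** * Series with given relations *)

Lemma big_fset_restrict (R : Type) (idx : R) (op : Monoid.com_law idx)
    (I : choiceType) (A B : {fset I}) (f : I -> R) : (A `<=` B)%fset ->
  \big[op/idx]_(i <- B | i \in A) f i = \big[op/idx]_(i <- A) f i.
Proof.
move=> /fsubsetP AB; rewrite -big_filter; apply/perm_big/uniq_perm.
- by rewrite filter_uniq ?fset_uniq.
- exact: fset_uniq.
by move=> i; rewrite mem_filter andb_idr // => /AB.
Qed.

Lemma lspan_fset (K : fieldType) (E : lmodType K) (I : choiceType)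
    (B : {fset I}) (f : I -> E) v : lspan (f @` [set` B]) v ->
  exists c : I -> K, v = \sum_(i <- B) c i *: f i.
Proof.
move: v; apply: (@lspan_min _ _ _ [set v | exists c : I -> K,
  v = \sum_(i <- B) c i *: f i]).
  split; first by exists (fun=> 0); rewrite big1 // => i _; rewrite scale0r.
  move=> a _ _ [c ->] [e ->]; exists (fun i => a * c i + e i).
  rewrite scaler_sumr -big_split; apply: eq_bigr => i _ /=.
  by rewrite scalerDl scalerA.
move=> _ [j jB <-]; exists (fun i => (i == j)%:R).
rewrite (bigD1_seq j) ?fset_uniq //= eqxx scale1r big1 ?addr0 //.
by move=> i /negPf ->; rewrite scale0r.
Qed.

Section Realization.
Local Open Scope fset_scope.
Local Open Scope ring_scope.
Variables (K : fieldType) (X : finType).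
Hypothesis hX : (0 < #|X|)%N.
Local Notation S := (series K X).
Variable T : fft X.
Implicit Types (A : S) (c : seq X -> seq X -> K) (e : seq X -> K) (u w l y : seq X).

(* The word [r] is read from its first letter, i.e. it is the reversal of the
   word at which the series is evaluated. *)
Fixpoint run c e (r : seq X) w : K :=
  if r is x :: r' then
    if w \in interior T then run c e r' (x :: w)
    else \sum_(y <- interior T) c w y * run c e r' (x :: y)
  else e w.

Definition realize c e : S := fun u => run c e (rev u) [::].

Definition triangular c : Prop := forall l y, c l y != 0 -> (wval y < wval l)%N.

Definition related A c : Prop := forall l, l \in leaves T ->
  tails A l = \sum_(y <- interior T) c l y *: tails A y.

Lemma run_vertex c e r w : w \in vertices T ->
  run c e (rev w ++ r) [::] = run c e r w.
Proof.
elim: w r => [|x w IHw] r //; rewrite vertices_consE => wI.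
rewrite rev_cons cat_rcons IHw ?(fsubsetP (interior_sub T)) //=.
by rewrite wI.
Qed.

Lemma realize_cat c e u w : w \in vertices T ->
  realize c e (u ++ w) = run c e (rev u) w.
Proof. by move=> wV; rewrite /realize rev_cat run_vertex. Qed.

Lemma realizeE c e w : w \in vertices T -> realize c e w = e w.
Proof. exact: (@realize_cat c e [::]). Qed.

Lemma sum_seriesE (I : Type) (r : seq I) (f : I -> S) w :
  (\sum_(i <- r) f i) w = \sum_(i <- r) f i w.
Proof. by elim/big_rec2: _ => // i y1 y2 _ <-. Qed.

(** Tails vanish at the empty word, so a relation does not constrain the value of [A] at the leaf
    itself. This is why vertex values can be chosen freely. *)
Lemma relatedP A c : related A c <->
  forall l u, l \in leaves T -> u != [::] ->
    A (u ++ l) = \sum_(y <- interior T) c l y * A (u ++ y).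
Proof.
split=> [rel l [|x u] // lT _|rel l lT].
  have := congr1 (fun B : S => B (x :: u)) (rel l lT).
  by rewrite sum_seriesE.
apply/funext => -[|x u]; rewrite sum_seriesE; last exact: rel.
by rewrite big1 // => y _; rewrite series_scaleE mulr0.
Qed.

Lemma run_leaf c e l u : l \in leaves T -> u != [::] ->
  run c e (rev u) l = \sum_(y <- interior T) c l y * run c e (rev u) y.
Proof.
case/lastP: u => // u x /(leaf_notin_interior hX) lI _.
rewrite rev_rcons /= (negPf lI); apply: eq_big_seq => y yI.
by rewrite ifT.
Qed.

Lemma realize_related c e : related (realize c e) c.
Proof.
apply/relatedP => l u lT u0.
rewrite realize_cat ?(fsubsetP (leaves_sub hX T)) // run_leaf //.
apply: eq_big_seq => y yI.
by rewrite realize_cat ?(fsubsetP (interior_sub T)).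
Qed.

(** Each letter read moves to a child; a word ending at a leaf is rewritten by the relation as a
    combination of words ending at interior vertices. Any series with these relations and vertex
    values therefore evaluates as [run] does. *)
Lemma related_realize A c e : related A c ->
  {in vertices T, forall w, A w = e w} -> A = realize c e.
Proof.
move=> /relatedP rel Ae; apply/funext => u.
suff H r w : w \in vertices T -> A (rev r ++ w) = run c e r w.
  by rewrite -[u in LHS]revK -[rev _]cats0 H ?fft_root.
elim: r w => [|x r IHr] w wV; first exact: Ae.
have step y : y \in interior T -> A (rev (x :: r) ++ y) = run c e r (x :: y).
  by move=> yI; rewrite rev_cons cat_rcons IHr // vertices_consE.
rewrite [RHS]/=; case: ifPn => [/step //|wI].
have wL : w \in leaves T by rewrite leavesE // wV.
rewrite rel -?size_eq0 ?size_rev //.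
by apply: eq_big_seq => y /step ->.
Qed.

Lemma related_lspan A c l : related A c -> triangular c -> l \in leaves T ->
  lspan (tails A @` lower l) (tails A l).
Proof.
move=> rel tri lT; rewrite rel //.
have Vsub := subspace_lspan (tails A @` lower l).
apply: subspace_sum => // y _.
have [->|cly] := eqVneq (c l y) 0; first by rewrite scale0r; exact: Vsub.1.
by apply: subspaceZ => //; apply: lspan_gen; exists y => //; exact: tri.
Qed.

(** A word outside the interior has a leaf as suffix, and a triangular relation prevents that leaf
    from being a pivot. *)
Lemma related_pivot A c w : related A c -> triangular c ->
  pivot (tails A) w -> w \in interior T.
Proof.
move=> rel tri; apply: contraTT => /(leaf_suffix hX)[u [l [-> lT]]].
apply: contraTN (lT) => /(pivot_suffix hX (shift_linear (X := X)) (fun x w => shift_tails x w A)).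
by move/pivotP; case; exact: related_lspan rel tri lT.
Qed.

Definition has_tree A T' : bool :=
  `[< forall w, pivot (tails A) w = (w \in interior T') >].

Lemma related_tree A c : related A c -> triangular c ->
  exists2 T', has_tree A T' & interior T' `<=` interior T.
Proof.
move=> rel tri; pose I' := [fset w in interior T | pivot (tails A) w].
have I'E w : (w \in I') = pivot (tails A) w.
  rewrite in_fset inE /= andb_idl //; exact: related_pivot rel tri.
have [|T' T'I] := fft_of_interior hX (I := I').
  move=> x w; rewrite !I'E.
  exact: (pivot_behead hX (shift_linear (X := X)) (fun x w => shift_tails x w A)).
exists T'; first by apply/asboolP => w; rewrite T'I I'E.
by rewrite T'I; apply/fsubsetP => w; rewrite I'E; exact: related_pivot rel tri.
Qed.

Variables (A : S) (T' : fft X).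
Hypothesis AT' : has_tree A T'.
Hypothesis T'T : interior T' `<=` interior T.

Let pivotE w : pivot (tails A) w = (w \in interior T').
Proof. by move/asboolP: AT'. Qed.

(** The difference of the two relations is a linear relation among pivots. *)
Lemma relation_unique c c' : related A c -> related A c' ->
    {in leaves T & interior T `\` interior T', forall l y, c l y = c' l y} ->
  {in leaves T & interior T, forall l y, c l y = c' l y}.
Proof.
move=> rel rel' cc' l y lT yI.
have [yI'|yI'] := boolP (y \in interior T'); last by apply: cc'; rewrite ?in_fsetD ?yI'.
apply/eqP; rewrite -subr_eq0; apply/eqP.
apply: (pivot_free hX (v := tails A) (B := interior T') (c := fun y => c l y - c' l y)) => //.
  by move=> w; rewrite pivotE.
rewrite -(big_fset_restrict _ _ T'T) big_mkcond /=.
transitivity (tails A l - tails A l); last by rewrite subrr.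
rewrite {1}rel // rel' // -sumrB; apply: eq_big_seq => z zI.
rewrite -scalerBl; case: ifPn => // zI'.
by rewrite cc' ?subrr ?scale0r // in_fsetD zI'.
Qed.

(** Subtracting the prescribed terms from [tails A l] leaves a combination of tails at non-pivots
    not after [l]. Each of these reduces to pivots before [l], which supplies the missing
    coefficients. *)
Lemma relation_exists c0 : triangular c0 -> exists c,
  [/\ related A c, triangular c &
      {in leaves T & interior T `\` interior T', forall l y, c l y = c0 l y}].
Proof.
move=> tri.
pose B l := [fset u in interior T' | (wval u < wval l)%N].
have inB l u : (u \in B l) = (u \in interior T') && (wval u < wval l)%N.
  by rewrite in_fset inE.
have spanB w l : (wval w <= wval l)%N -> ~~ pivot (tails A) w ->
    lspan (tails A @` [set` B l]) (tails A w).
  move=> wl /npivot_span; apply: lspan_mono => _ [u [pu uw] <-].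
  by exists u => //=; rewrite inB -pivotE pu (leq_trans uw).
have /choice[d dE] l : exists d : seq X -> K, l \in leaves T ->
    tails A l - \sum_(y <- interior T | y \notin interior T') c0 l y *: tails A y
    = \sum_(u <- B l) d u *: tails A u.
  have [lT|] := boolP (l \in leaves T); last by exists (fun=> 0).
  have Vsub := subspace_lspan (tails A @` [set` B l]).
  suff /lspan_fset[d dE] : lspan (tails A @` [set` B l])
      (tails A l - \sum_(y <- interior T | y \notin interior T') c0 l y *: tails A y).
    by exists d.
  rewrite addrC -scaleN1r; apply: Vsub.2.
    apply: subspace_sum => // y yI'.
    have [->|cly] := eqVneq (c0 l y) 0; first by rewrite scale0r; exact: Vsub.1.
    by apply: subspaceZ => //; apply: spanB; rewrite ?pivotE // ltnW ?tri.
  apply: spanB => //; rewrite pivotE; apply: contraNN (leaf_notin_interior hX lT).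
  exact: fsubsetP.
(* Zero at pivots not before [l] keeps the coefficients triangular. *)
exists (fun l y => if y \in interior T' then
                     if (wval y < wval l)%N then d l y else 0 else c0 l y).
split=> [l lT|l y|l y lT].
- apply/eqP; rewrite [X in _ == X](bigID (fun y => y \in interior T')) /=.
  rewrite -subr_eq; apply/eqP.
  transitivity (\sum_(u <- B l) d l u *: tails A u).
    rewrite -dE //; congr (_ - _); apply: eq_bigr => y /negPf yI'.
    by rewrite yI'.
  rewrite big_fset_restrict // -[LHS](big_fset_restrict _ _ (B := interior T')).
    rewrite big_seq_cond [RHS]big_seq_cond big_mkcond [RHS]big_mkcond.
    apply: eq_bigr => y _; rewrite inB andbT.
    case yI': (y \in interior T') => //=.
    by case: ifP => _; rewrite ?scale0r.
  by apply/fsubsetP => y; rewrite inB => /andP[].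
- case: ifP => _; last exact: tri.
  by case: ifP => //; rewrite eqxx.
by rewrite in_fsetD => /andP[/negPf ->].
Qed.

End Realization.

(** * Counting *)

Section Counting.
Local Open Scope fset_scope.
Local Open Scope ring_scope.
Variables (X : finType) (F : finFieldType).
Hypothesis hX : (0 < #|X|)%N.
Local Notation S := (series F X).
Local Notation q := (#|F|%:Z).

Definition wlt : rel (seq X) := fun u w => (wval u < wval w)%N.

Section Data.
Variable T : fft X.
Local Notation V := (vertices T).
Implicit Types (A : S) (J : {fset seq X}) (l y w : seq X).

(** The places where a triangular coefficient may be non-zero, inside a finite type. *)
Definition pairs J : {pred V * V} :=
  [pred p | [&& fsval p.1 \in leaves T, fsval p.2 \in J &
             wlt (fsval p.2) (fsval p.1)]].

Lemma in_pairs J p : (p \in pairs J) =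
  [&& fsval p.1 \in leaves T, fsval p.2 \in J & wlt (fsval p.2) (fsval p.1)].
Proof. by []. Qed.

Lemma card_pairs J : J `<=` V ->
  #|pairs J| = (\sum_(l <- leaves T) #|` [fset Z in J | wlt Z l]|)%N.
Proof.
move=> JV; rewrite -sum1_card.
rewrite -(big_fset_restrict _ _ (leaves_sub hX T)) big_seq_fsetE /=.
rewrite [LHS](eq_bigl (fun p : V * V => (fsval p.1 \in leaves T) &&
  ((fsval p.2 \in J) && wlt (fsval p.2) (fsval p.1)))) //.
rewrite -(pair_big_dep (fun l : V => fsval l \in leaves T)
  (fun l y : V => (fsval y \in J) && wlt (fsval y) (fsval l)) (fun _ _ => 1%N)) /=.
apply: eq_bigr => l _; rewrite -sum1_size.
rewrite -(big_fset_restrict _ _ (B := V)); last first.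
  apply/fsubsetP => Z; rewrite in_fset inE => /andP[ZJ _].
  exact: (fsubsetP JV).
by rewrite big_seq_fsetE; apply: eq_bigl => y; rewrite in_fset inE.
Qed.

(** At the cardinality of the field, the leaf weight is thus the number of triangular coefficient
    families with columns in [J]. *)
Lemma leaf_weightE J : J `<=` V ->
  leaf_weight q wlt (leaves T) J = (#|F| ^ #|pairs J|)%:Z.
Proof.
move=> /card_pairs ->; rewrite /leaf_weight -[RHS]natz natrX natz.
exact: prodrXr.
Qed.

Definition coef (g : {ffun V * V -> F}) l y : F :=
  if insub l is Some l' then
    if insub y is Some y' then g (l', y') else 0 else 0.

Definition init (e : {ffun V -> F}) w : F :=
  if w == [::] then 1 else if insub w is Some w' then e w' else 0.

Lemma coefE g (p : V * V) : coef g (fsval p.1) (fsval p.2) = g p.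
Proof. by case: p => l y; rewrite /coef !valK. Qed.

Definition root : V := [` fft_root T].

(** The support conditions avoid double counting: entries never read are zero, including the one at
    the root, where [init] imposes the constant coefficient 1. *)
Definition data : {set {ffun V * V -> F} * {ffun V -> F}} :=
  finset.setX [set g in pffun_on 0 (pairs (interior T)) predT]
       [set e in pffun_on 0 (predC1 root) predT].

Lemma card_data :
  #|data| = (#|F| ^ #|pairs (interior T)| * #|F| ^ #|` V|.-1)%N.
Proof.
by rewrite cardsX !cardsE !card_pffun_on cardC1 -cardfE.
Qed.

Definition realization (g : {ffun V * V -> F} * {ffun V -> F}) : S :=
  realize T (coef g.1) (init g.2).

Lemma pffunP (D : finType) (P : {pred D}) (f : {ffun D -> F}) :
  reflect (forall p, p \notin P -> f p = 0) (f \in pffun_on 0 P predT).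
Proof.
apply: (iffP (@pffun_onP _ _ 0 P predT f)) => [[/supportP fP _] //|fP].
by split; [apply/supportP|].
Qed.

Lemma dataP (g : {ffun V * V -> F} * {ffun V -> F}) : reflect ((forall p, p \notin pairs (interior T) -> g.1 p = 0)
    /\ g.2 root = 0) (g \in data).
Proof.
rewrite finset.inE !inE.
apply: (iffP andP) => [[/pffunP g1 /pffunP g2]|[g1 g2]].
  by split => //; apply: g2; rewrite !inE eqxx.
split; apply/pffunP => // p; rewrite !inE negbK => /eqP ->.
exact: g2.
Qed.

Lemma coef_triangular (g : {ffun V * V -> F}) J :
  (forall p, p \notin pairs J -> g p = 0) -> triangular (coef g).
Proof.
move=> gJ l y; rewrite /coef; case: insubP => [l' _ <-|]; last by rewrite eqxx.
case: insubP => [y' _ <-|]; last by rewrite eqxx.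
by apply: contra_neqT => yl; apply: gJ; rewrite in_pairs /wlt (negPf yl) !andbF.
Qed.

Lemma realization_related g : related T (realization g) (coef g.1).
Proof. exact: realize_related. Qed.

Lemma realization1 g : epsilon (realization g) = 1.
Proof. by rewrite /epsilon /realization realizeE ?fft_root. Qed.

Definition datum A (c : seq X -> seq X -> F) : {ffun V * V -> F} * {ffun V -> F} :=
  ([ffun p => if p \in pairs (interior T) then c (fsval p.1) (fsval p.2) else 0],
   [ffun w => if w == root then 0 else A (fsval w)]).

Lemma datum_data A c : datum A c \in data.
Proof.
by apply/dataP; split=> [p /negPf pP|]; rewrite /= ffunE ?pP ?eqxx.
Qed.

Lemma coef_datum A c : triangular c ->
  {in leaves T & interior T, forall l y, coef (datum A c).1 l y = c l y}.
Proof.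
move=> tri l y lT yI.
have lV := fsubsetP (leaves_sub hX T) _ lT.
have yV := fsubsetP (interior_sub T) _ yI.
rewrite -[l]/(fsval ([` lV], [` yV]).1) -[y]/(fsval ([` lV], [` yV]).2) coefE ffunE.
case: ifPn => //; rewrite in_pairs /= lT yI /= => ly; apply/esym/eqP.
by apply: contraNT ly; exact: tri.
Qed.

Lemma realization_datum A c : epsilon A = 1 -> triangular c -> related T A c ->
  realization (datum A c) = A.
Proof.
move=> A1 tri rel; apply/esym/(related_realize hX).
  move=> l lT; rewrite rel //; apply: eq_big_seq => y yI.
  by rewrite coef_datum.
move=> w wV; rewrite /init; case: eqP => [->//|w0].
by rewrite insubT ffunE; case: eqP => // /(congr1 val) /w0.
Qed.

Definition realizable : {fset S} := [fset realization g | g in data].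

Lemma in_realizable A : reflect
  (epsilon A = 1 /\ exists2 T', has_tree A T' & interior T' `<=` interior T)
  (A \in realizable).
Proof.
apply: (iffP (imfsetP _ _ _ _)) => [[g /dataP[g1 _] ->]|[A1 [T' AT' T'T]]].
  split; first exact: realization1.
  exact: (related_tree hX (realization_related g) (coef_triangular g1)).
(* Any prescribed coefficients outside [T'] would do; zero is chosen. *)
have [|c [rel tri _]] := relation_exists hX AT' T'T (c0 := fun _ _ => 0).
  by move=> l y; rewrite eqxx.
exists (datum A c); first exact: datum_data.
by rewrite realization_datum.
Qed.

Definition fibre A := [set g in data | A == realization g].

(** Restricting coefficients to columns outside [T'] is injective on the fibre by [relation_unique],
    and reaches every choice by [relation_exists]. *)
Lemma card_fibre A T' : epsilon A = 1 -> has_tree A T' ->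
  interior T' `<=` interior T ->
  #|fibre A| = (#|F| ^ #|pairs (interior T `\` interior T')|)%N.
Proof.
move=> A1 AT' T'T; pose P := pairs (interior T `\` interior T').
pose phi (g : {ffun V * V -> F} * {ffun V -> F}) : {ffun V * V -> F} :=
  [ffun p => if p \in P then g.1 p else 0].
have subP p : p \notin pairs (interior T) -> p \notin P.
  apply: contraNN; rewrite !in_pairs => /and3P[-> + ->].
  by rewrite in_fsetD => /andP[_ ->].
rewrite -(card_in_imset (f := phi)); last first.
  move=> [g e] [g' e'] /setIdP[/dataP[/= g0 e0] /eqP gA].
  move=> /setIdP[/dataP[/= g0' e0'] /eqP gA'] /ffunP phiE.
  have rel : related T A (coef g) by rewrite gA; exact: realization_related.
  have rel' : related T A (coef g') by rewrite gA'; exact: realization_related.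
  have gg' : {in leaves T & interior T, forall l y, coef g l y = coef g' l y}.
    apply: (relation_unique hX AT' T'T rel rel') => l y lT yI.
    have lV := fsubsetP (leaves_sub hX T) _ lT.
    have yV : y \in V.
      by move: yI; rewrite in_fsetD => /andP[_]; exact: (fsubsetP (interior_sub T)).
    rewrite -[l]/(fsval ([` lV], [` yV]).1) -[y]/(fsval ([` lV], [` yV]).2).
    rewrite !coefE; have := phiE ([` lV], [` yV]); rewrite !ffunE.
    case: ifPn => // pP _; rewrite g0 ?g0' //.
      by apply: contraNN pP; rewrite !in_pairs yI => /and3P[-> _ ->].
    by apply: contraNN pP; rewrite !in_pairs yI => /and3P[-> _ ->].
  congr (_, _); apply/ffunP => p.
    have [|pP] := boolP (p \in pairs (interior T)); last by rewrite g0 ?g0'.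
    by rewrite in_pairs => /and3P[lT yI _]; rewrite -!coefE gg'.
  (* The remaining vertex values are read off the series [A] itself. *)
  have [->|p0] := eqVneq p root; first by rewrite e0 e0'.
  have initE (e1 : {ffun V -> F}) : init e1 (fsval p) = e1 p.
    by rewrite /init -val_eqE /= in p0 *; rewrite (negPf p0) valK.
  by rewrite -!initE -(realizeE (T := T) (coef g)) -1?(realizeE (T := T) (coef g') (init e'))
     ?fsvalP // -[realize _ _ _]/(realization (g, e)) -gA gA'.
rewrite -(card_pffun_on 0 P predT); apply: eq_card => f.
apply/imsetP/pffunP => [[g _ ->] p /negPf pP|f0]; first by rewrite ffunE pP.
have [|c [rel tri cE]] := relation_exists hX AT' T'T (c0 := coef f).
  exact: coef_triangular f0.
exists (datum A c).
  by rewrite inE datum_data realization_datum ?eqxx.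
apply/ffunP => p; rewrite ffunE; case: ifPn => [pP|/f0 //].
have pI : p \in pairs (interior T) by apply: contraLR pP; exact: subP.
rewrite ffunE pI cE ?coefE //; by move: pP; rewrite in_pairs; case/and3P.
Qed.

Lemma data_identity :
  q ^+ #|` V|.-1 * leaf_weight q wlt (leaves T) (interior T) =
  \sum_(A <- realizable) #|fibre A|%:Z.
Proof.
rewrite leaf_weightE ?interior_sub // mulrC -[q]natz -natrX natz -PoszM.
rewrite -card_data -sum1_card -natz natr_sum.
transitivity (\sum_(g in data) \sum_(A <- realizable | A == realization g) (1 : int)).
  apply: eq_bigr => g gD; rewrite big_mkcond (bigD1_seq (realization g)) /=.
  - by rewrite eqxx big1 ?addr0 // => A /negPf ->.
  - exact: in_imfset.
  - exact: fset_uniq.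
rewrite (exchange_big_dep xpredT) //=; apply: eq_bigr => A _.
rewrite -[RHS]natz -sum1_card natr_sum; apply: eq_bigl => g.
by rewrite [RHS]inE.
Qed.

End Data.

Lemma finite_has_tree (T : fft X) :
  finite_set [set A : S | epsilon A = 1 /\ has_tree A T].
Proof.
apply: sub_finite_set (finite_fset (realizable T)) => A [A1 AT] /=.
by apply/in_realizable; split=> //; exists T; rewrite ?fsubset_refl.
Qed.

Definition treeset (T : fft X) : {fset S} :=
  fset_set [set A : S | epsilon A = 1 /\ has_tree A T].

Lemma in_treeset T A : (A \in treeset T) = (epsilon A == 1) && has_tree A T.
Proof.
rewrite in_fset_set; last exact: finite_has_tree.
by apply/idP/andP => [|[/eqP A1 AT]]; rewrite inE => // -[/= -> ->].
Qed.

Lemma has_tree_inj (A : S) T T' : has_tree A T -> has_tree A T' -> T = T'.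
Proof.
move=> /asboolP AT /asboolP AT'; apply: interior_inj; apply/fsetP => w.
by rewrite -AT AT'.
Qed.

(** [data_identity] counts the data on [T] series by series. Grouping the realizable series by their
    tree [T'] turns each fibre size into a leaf weight, and the term [T' = T] is then isolated. *)
Lemma treeset_recursion :
  tree_recursion q wlt (fun T => #|` treeset T|%:Z).
Proof.
move=> T; rewrite data_identity; apply/esym/eqP; rewrite subr_eq; apply/eqP.
(* For [T' = T] no coefficient is free, so the weight is 1 and this term fits the general form. *)
have -> : #|` treeset T|%:Z =
  #|` treeset T|%:Z * leaf_weight q wlt (leaves T) (interior T `\` interior T).
  rewrite fsetDv /leaf_weight big1 ?mulr1 // => l _.
  by rewrite (_ : [fset Z in fset0 | wlt Z l] = fset0) ?cardfs0 //;
    apply/fsetP => Z; rewrite in_fset !inE.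
pose W T' := leaf_weight q wlt (leaves T) (interior T `\` interior T').
have Tsub : T \notin subtrees T by rewrite in_subtrees /tree_lt fproperE fsubset_refl.
have in_sub T' : (T' \in T |` subtrees T) = (interior T' `<=` interior T).
  rewrite in_fset1U in_subtrees /tree_lt fproperEneq -(inj_eq (@interior_inj X)).
  by case: eqP => //= ->; rewrite fsubset_refl.
transitivity (\sum_(T' <- T |` subtrees T) #|` treeset T'|%:Z * W T'); last first.
  by rewrite big_fsetU1.
transitivity (\sum_(A <- realizable T)
    \sum_(T' <- T |` subtrees T | has_tree A T') W T').
  apply: eq_big_seq => A /in_realizable[A1 [T' AT' T'T]].
  rewrite big_mkcond (bigD1_seq T') ?fset_uniq ?in_sub //= AT'.
  rewrite big1 ?addr0 => [|T1 T1T']; last first.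
    by case: ifPn => // /(has_tree_inj AT') T'T1; rewrite T'T1 eqxx in T1T'.
  rewrite (card_fibre A1 AT' T'T) /W leaf_weightE //.
  by apply: fsubset_trans (fsubsetDl _ _) (interior_sub T).
rewrite (exchange_big_dep xpredT) //=; apply: eq_big_seq => T'; rewrite in_sub => T'T.
rewrite -big_filter -natz -sum1_size natr_sum mulr_suml.
under [RHS]eq_bigr do rewrite mul1r.
apply/perm_big/uniq_perm; rewrite ?filter_uniq ?fset_uniq // => A.
rewrite mem_filter andbC; change ((A \in realizable T) && has_tree A T' = (A \in treeset T')).
rewrite in_treeset; have [AT'|] := boolP (has_tree A T'); rewrite ?andbF ?andbT //.
apply/in_realizable/eqP => [[]//|A1]; split=> //.
by exists T'.
Qed.

Lemma SRat_treeset (A : S) n : SRat A /\ norm A = n <->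
  exists2 T, T \in level X n & A \in treeset T.
Proof.
split=> [[[ratA A1] An]|[T]].
  have [T AT] := rational_pivot hX ratA; exists T.
    by rewrite in_level -An (norm_pivot hX AT).
  by rewrite in_treeset A1 eqxx; apply/asboolP.
rewrite in_level in_treeset => /eqP Tn /andP[/eqP A1 /asboolP AT].
by rewrite (norm_pivot hX AT); split=> //; split=> //; exact: pivot_rational AT.
Qed.

Definition length_set n : {fset S} := \bigcup_(T <- level X n) treeset T.

Lemma in_length_set n : [set` length_set n] = [set A : S | SRat A /\ norm A = n].
Proof.
apply/seteqP; split=> A /=.
  by move=> /bigfcupP[T]; rewrite andbT => Tn AT; apply/SRat_treeset; exists T.
by move=> /SRat_treeset[T Tn AT]; apply/bigfcupP; exists T; rewrite ?Tn.
Qed.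

(** A series has only one tree, so the union is disjoint. *)
Lemma card_length_set n :
  #|` length_set n|%:Z = \sum_(T <- level X n) #|` treeset T|%:Z.
Proof.
rewrite -[LHS]natz -sum1_size natr_sum.
transitivity (\sum_(A <- length_set n) \sum_(T <- level X n | A \in treeset T) (1 : int)).
  apply: eq_big_seq => A /bigfcupP[T]; rewrite andbT => Tn AT.
  rewrite big_mkcond (bigD1_seq T) ?fset_uniq //= AT big1 ?addr0 // => T' T'T.
  case: ifPn => //; move: AT; rewrite !in_treeset => /andP[_ AT] /andP[_].
  by move=> /(has_tree_inj AT) TT'; rewrite TT' eqxx in T'T.
rewrite (exchange_big_dep xpredT) //=; apply: eq_big_seq => T Tn.
rewrite big_fset_restrict; first by rewrite -[RHS]natz -sum1_size natr_sum.
by apply/fsubsetP => A AT; apply/bigfcupP; exists T; rewrite ?Tn.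
Qed.

End Counting.

(** * From the lexicographic recursion to the count of series *)

Lemma word_lt_order (d : Order.disp_t) (X : finOrderType d) :
  word_order (@word_lt d X).
Proof.
split=> [u|u v w|u w|x w].
- by rewrite /word_lt ltxx.
- exact: lt_trans.
- rewrite -(inj_eq (can_inj (@revK X))) => uw.
  by rewrite /word_lt; case: (ltgtP (rev u : seqlexi X) (rev w)) uw => // ->; rewrite eqxx.
exact: (word_lt_suffix x [::] w).
Qed.

Lemma tree_poly_recursion (d : Order.disp_t) (X : finOrderType d) (q : int) :
  tree_recursion q (@word_lt d X) (fun T => (tree_poly T).[q]).
Proof.
have weightE (T : fft X) I : (leaf_prod T I).[q] = leaf_weight q (@word_lt d X) (leaves T) I.
  rewrite /leaf_prod horner_prod; apply: eq_bigr => l _.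
  by rewrite hornerXn.
move=> T; rewrite tree_polyE hornerD hornerN hornerM hornerXn weightE.
congr (_ - _); rewrite /tree_corr fsbig_finite; last exact: finite_tree_lt.
rewrite horner_sum; apply: eq_bigr => T' _.
by rewrite hornerM weightE.
Qed.

Theorem theorem8p12 (d : Order.disp_t) (X : finOrderType d)
    (F : finFieldType) (hX : (0 < #|X|)%N) :
  gen_series (@SRat F X) (fun=> 1) (@norm F X)
    = gen_series [set: fft X] (fun T => (tree_poly T).[#|F|%:Z])
        (fun T => #|` interior T|)
  /\ forall n : nat, exists N : nat,
       [set A : series F X | SRat A /\ norm A = n] #= `I_N
       /\ N%:Z = (level_poly X n).[#|F|%:Z].
Proof.
(* The series obey the recursion for [wval], the polynomials the one for the lexicographic order;
   only the level sums are compared. *)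
have count n : #|` length_set X F n|%:Z =
    \sum_(T <- level X n) (tree_poly T).[#|F|%:Z].
  rewrite (card_length_set F hX).
  exact: (level_sum_eq hX (wval_order hX) (word_lt_order X)
    (treeset_recursion F hX) (tree_poly_recursion _)).
split.
  apply/funext => n; rewrite /gen_series setTI.
  rewrite [RHS]fsbig_finite; last exact: finite_fft_card.
  rewrite -count (_ : _ `&` _ = [set` length_set X F n]); last by rewrite (in_length_set F hX).
  rewrite fsbig_finite ?set_fsetK; last exact: finite_fset.
  by rewrite -[RHS]natz -sum1_size natr_sum.
move=> n; exists #|` length_set X F n|; split.
  by rewrite -(in_length_set F hX n); apply/card_eq_fsetP.
rewrite count /level_poly fsbig_finite; last exact: finite_fft_card.
by rewrite horner_sum.
Qed.
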